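(* Let $\Lambda$ be a finite, strongly connected $k$-graph, let $\delta\in(0,1)$, and suppose that $w_\delta$ is a weight satisfying $w_\delta(\lambda)=\operatorname{diam}[\lambda]$ for all $\lambda\in F\mathcal B_\Lambda$. Let $\tau$ be a choice function. Then for every $\lambda\in F\mathcal B_\Lambda$ the operator $\pi_\tau(\chi_{[\lambda]})|D|^{-\delta}$ is measurable in the sense of Connes, and $\mathcal T\big(\pi_\tau(\chi_{[\lambda]})|D|^{-\delta}\big)=\lim_{s\searrow1}(s-1)\operatorname{Tr}\big((\pi_\tau(\chi_{[\lambda]})|D|^{-\delta})^s\big)$ is finite and positive.
   Context: $\mathbb N=\{0,1,2,\dots\}$. A $k$-graph ($k\ge 1$) is a countable small category $\Lambda$ with a functor $d:\Lambda\to\mathbb N^k$ ($\mathbb N^k$ viewed as a one-object category under addition) such that whenever $d(\lambda)=m+n$ there are unique $\mu,\nu\in\Lambda$ with $d(\mu)=m$, $d(\nu)=n$, $\lambda=\mu\nu$. Here $\lambda\in\Lambda$ means $\lambda$ is a morphism; $\Lambda^n=d^{-1}(n)$; $\Lambda^0$ is identified with the objects (vertices); $r,s:\Lambda\to\Lambda^0$ are range and source. $\Lambda$ is finite if every $\Lambda^n$ is finite, and strongly connected if for all $v,w\in\Lambda^0$ there is $\lambda\in\Lambda$ with $r(\lambda)=v$, $s(\lambda)=w$. With $e_i$ the standard basis of $\mathbb N^k$, the adjacency matrices are $A_i(v,w)=\#\{\lambda\in\Lambda^{e_i}: r(\lambda)=v,\ s(\lambda)=w\}$; $\rho_i$ is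 the spectral radius of $A_i$. For $\Lambda$ finite and strongly connected, $x^\Lambda\in(0,\infty)^{\Lambda^0}$ is the unique positive vector with $\sum_v x^\Lambda_v=1$ and $A_ix^\Lambda=\rho_ix^\Lambda$ for $1\le i\le k$. The stationary $k$-Bratteli diagram $\mathcal B_\Lambda$ has vertex set $\bigsqcup_{n\ge0}\mathcal V_n$, each $\mathcal V_n$ a copy of $\Lambda^0$, and edge set $\bigsqcup_{n\ge1}\mathcal E_n$, where for $n\equiv i \pmod k$, $1\le i\le k$, $\mathcal E_n$ contains exactly $A_i(p,q)$ edges with range $p\in\mathcal V_{n-1}$ and source $q\in\mathcal V_n$. $F\mathcal B_\Lambda$ is the set of finite paths $\eta=\eta_1\cdots\eta_m$ ($\eta_i\in\mathcal E_i$, $s(\eta_i)=r(\eta_{i+1})$), of length $|\eta|=m$; vertices in $\mathcal V_0$ are the paths of length $0$. $X_{\mathcal B_\Lambda}$ is the set of infinite paths $(x_n)_{n\ge1}$, $x_n\in\mathcal E_n$, $s(x_n)=r(x_{n+1})$, with the topology generated by the cylinder sets $[\lambda]$ = set of infinite paths with initial segment $\lambda\in F\mathcal B_\Lambda$; $\chi_{[\lambda]}$ is the characteristic function of $[\lambda]$. A weight is a function $w:F\mathcal B_\Lambda\to(0,\infty)$ with $\sum_{v\in\mathcal V_0}w(v)\le1$, $\lim_{n}\sup\{w(\lambda):|\lambda|=n\}=0$, and $w(\lambda)<w(\eta)$ whenever $\eta$ is a proper initial segment of $\lambda$. For $\delta\in(0,1)$ and $|\eta|=qk+t$ with $q\in\mathbb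 N$, $0\le t\le k-1$, $$w_\delta(\eta)=\big(\rho_1^{q+1}\cdots\rho_t^{q+1}\rho_{t+1}^q\cdots\rho_k^q\big)^{-1/\delta}x^\Lambda_{s(\eta)}.$$ For $x\ne y$ in $X_{\mathcal B_\Lambda}$, $x\wedge y$ is the longest common initial segment in $F\mathcal B_\Lambda$ ($\emptyset$ if $r(x)\neq r(y)$); $d_\delta(x,y)=w_\delta(x\wedge y)$ if $x\wedge y\ne\emptyset$, $d_\delta(x,y)=1$ if $x\wedge y=\emptyset$, and $d_\delta(x,x)=0$; $\operatorname{diam}[\lambda]=\sup\{d_\delta(x,y):x,y\in[\lambda]\}$. Under the hypotheses of the claim, $X_{\mathcal B_\Lambda}$ is a Cantor set and $d_\delta$ is an ultrametric inducing its topology. A choice function is a map $\tau=(\tau_+,\tau_-):F\mathcal B_\Lambda\to X_{\mathcal B_\Lambda}\times X_{\mathcal B_\Lambda}$ with $\tau(\gamma)\in[\gamma]\times[\gamma]$ and $d_\delta(\tau_+(\gamma),\tau_-(\gamma))=\operatorname{diam}[\gamma]$. On $\mathcal H=\ell^2(F\mathcal B_\Lambda,\mathbb C^2)$, for $f\in C(X_{\mathcal B_\Lambda})$, put $\pi_\tau(f)=\bigoplus_\gamma\mathrm{diag}(f(\tau_+(\gamma)),f(\tau_-(\gamma)))$ and $D=\bigoplus_\gamma\frac1{\operatorname{diam}[\gamma]}\begin{pmatrix}0&1\\1&0\end{pmatrix}$; then $|D|^{-1}$ is multiplication by $\operatorname{diam}[\gamma]$ on the $\gamma$-summand. Let $\sigma_0(T)\ge\sigma_1(T)\ge\cdots$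 be the singular values of a compact operator $T$ on a separable Hilbert space, with multiplicity. The Dixmier–Macaev ideal $\mathcal M_{1,\infty}$ consists of the compact $T$ with $\limsup_n\frac1{\ln n}\sum_{j=1}^n\sigma_j(T)<\infty$. For a (dilation-invariant) generalized limit $\omega$ on $\ell^\infty(\mathbb N)$ (a state vanishing on $c_0$), the Dixmier trace $\mathcal T_\omega$ is the linear functional on $\mathcal M_{1,\infty}$ given on positive $T$ by $\mathcal T_\omega(T)=\omega\big(\big(\frac1{\ln(2+n)}\sum_{j\le n}\sigma_j(T)\big)_n\big)$. $T\in\mathcal M_{1,\infty}$ is measurable in the sense of Connes if $\mathcal T_\omega(T)$ is the same for all such $\omega$; the common value is denoted $\mathcal T(T)$. For positive $T$, Connes measurability is equivalent to existence and finiteness of $\lim_{s\searrow1}(s-1)\operatorname{Tr}(T^s)$, and then $\mathcal T(T)$ equals this limit. *)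

(* Defs.v *)
From HB Require Import structures.
From mathcomp Require Import all_boot all_order all_algebra.
From mathcomp Require Import complex finmap.
From mathcomp Require Import all_classical all_reals all_analysis.
From mathcomp Require Import ring lra.

Set Implicit Arguments.
Unset Strict Implicit.
Unset Printing Implicit Defensive.

Import Order.TTheory GRing.Theory Num.Theory.
Import numFieldNormedType.Exports.
Import Normc.

Local Open Scope classical_set_scope.
Local Open Scope ring_scope.
Local Open Scope complex_scope.

Section Ell2.
Context (R : realType) (I : choiceType).
Implicit Types f g : I -> R[i].

Definition sqsum f : \bar R := \esum_(i in [set: I]) (normc (f i) ^+ 2)%:E.

Lemma sqsum_ge0 f : (0 <= sqsum f)%E.
Proof. by apply: esum_ge0 => i _; rewrite lee_fin sqr_ge0. Qed.

Lemma esumZ_le (c : R) (a : I -> R) : 0 <= c -> (forall i, 0 <= a i) ->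
  (\esum_(i in [set: I]) (c * a i)%:E <= c%:E * \esum_(i in [set: I]) (a i)%:E)%E.
Proof.
move=> c0 a0; apply: ge_ereal_sup => _ [F [finF _] <-].
under eq_fsbigr do rewrite EFinM.
rewrite -ge0_mule_fsumr//.
apply: lee_wpmul2l; first by rewrite lee_fin.
by apply: ereal_sup_ubound; exists F => //; split.
Qed.

Lemma sqsumZ_le (l : R[i]) f :
  (sqsum (l *: f)%R <= (normc l ^+ 2)%:E * sqsum f)%E.
Proof.
rewrite /sqsum; under eq_esum do rewrite normcM exprMn.
by apply: esumZ_le => [|i]; rewrite sqr_ge0.
Qed.

Lemma sqsumD_le (t : R) f g : 0 < t ->
  (sqsum (f + g)%R <= (1 + t)%:E * sqsum f + (1 + t^-1)%:E * sqsum g)%E.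
Proof.
move=> t0; have ti0 : 0 < t^-1 by rewrite invr_gt0.
apply: (@le_trans _ _ (\esum_(i in [set: I]) (((1 + t) * normc (f i) ^+ 2)%:E +
    ((1 + t^-1) * normc (g i) ^+ 2)%:E))%E).
  apply: le_esum => i _; rewrite -EFinD lee_fin.
  have nc0 (z : R[i]) : 0 <= normc z by case: z => ? ?; exact: sqrtr_ge0.
  have H : normc (f i + g i) ^+ 2 <= (normc (f i) + normc (g i)) ^+ 2.
    by rewrite ler_sqr ?nnegrE ?addr_ge0// le_normcD.
  apply: (le_trans H); set x := normc (f i); set y := normc (g i).
  have : 0 <= t^-1 * (t * x - y) ^+ 2 by rewrite mulr_ge0 ?sqr_ge0 ?ltW.
  rewrite (_ : t^-1 * (t * x - y) ^+ 2 =
    (1 + t) * x ^+ 2 + (1 + t^-1) * y ^+ 2 - (x + y) ^+ 2).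
    by rewrite subr_ge0.
  by field; rewrite gt_eqF.
rewrite esumD; [|by move=> i _; rewrite lee_fin mulr_ge0 ?sqr_ge0 ?addr_ge0 ?ltW..].
by apply: leeD; apply: esumZ_le => [|i]; rewrite ?sqr_ge0 ?addr_ge0 ?ltW.
Qed.

Definition square_summable : {pred I -> R[i]} := fun f => `[< (sqsum f < +oo)%E >].

Lemma square_summableP f : reflect (sqsum f < +oo)%E (f \in square_summable).
Proof. exact: asboolP. Qed.

Lemma square_summable_submod : submod_closed square_summable.
Proof.
split=> [|l f g /square_summableP sf /square_summableP sg].
  apply/square_summableP; rewrite /sqsum esum1// => i _ /=.
  by congr EFin; apply/eqP; rewrite sqrf_eq0; apply/eqP; exact: normc0.
apply/square_summableP; apply: (le_lt_trans (sqsumD_le _ _ ltr01)).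
have l1 : (0 <= 1 + (1 : R)) by rewrite addr_ge0.
apply: lte_add_pinfty; apply: lte_mul_pinfty; rewrite ?lee_fin ?invr1//.
apply: (le_lt_trans (sqsumZ_le _ _)).
by apply: lte_mul_pinfty; rewrite ?lee_fin ?sqr_ge0.
Qed.
HB.instance Definition _ :=
  GRing.isSubmodClosed.Build _ _ square_summable square_summable_submod.

(* The Hilbert space l^2(I, C). *)
Record ell2 := Ell2 {
  ell2_fun :> I -> R[i] ;
  _ : ell2_fun \in square_summable }.
HB.instance Definition _ := [isSub for ell2_fun].
HB.instance Definition _ := [Choice of ell2 by <:].
HB.instance Definition _ := [SubChoice_isSubLmodule of ell2 by <:].

Definition ell2_norm (u : ell2) : R[i] := (Num.sqrt (fine (sqsum u)))%:C.

Lemma sqsum_fin (u : ell2) : (sqsum u)%E \is a fin_num.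
Proof.
rewrite ge0_fin_numE ?sqsum_ge0//.
by case: u => f /= /square_summableP.
Qed.

Lemma ell2_norm0_eq0 u : ell2_norm u = 0 -> u = 0.
Proof.
case=> /eqP; rewrite sqrtr_eq0 => u0.
have {}u0 : sqsum u = 0%E.
  apply/eqP; rewrite eq_le sqsum_ge0 andbT -(fineK (sqsum_fin u)) lee_fin//.
apply/val_inj/funext => i /=.
have : ((normc (u i) ^+ 2)%:E <= sqsum u)%E.
  apply: esum_ge; exists [set i]; first by split.
  by rewrite fsbig_set1.
rewrite u0 lee_fin => ui; apply: eq0_normc.
by apply/eqP; rewrite -sqrf_eq0 eq_le ui sqr_ge0.
Qed.

Lemma ell2_normZ_le (l : R[i]) (u : ell2) :
  fine (sqsum (l *: u)) <= normc l ^+ 2 * fine (sqsum u).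
Proof.
rewrite -lee_fin fineK; last exact: sqsum_fin.
rewrite EFinM fineK ?sqsum_fin//; exact: sqsumZ_le.
Qed.

Lemma ell2_normZ (l : R[i]) u : ell2_norm (l *: u) = `|l| * ell2_norm u.
Proof.
have -> : `|l| = (normc l)%:C by case: l.
have nl0 : 0 <= normc l by case: (l) => ? ?; exact: sqrtr_ge0.
rewrite /ell2_norm -rmorphM/=; congr (_%:C).
rewrite -[in RHS](ger0_norm nl0) -sqrtr_sqr -sqrtrM ?sqr_ge0//.
congr (Num.sqrt _); apply/eqP; rewrite eq_le ell2_normZ_le/=.
have [->|l0] := eqVneq l 0.
  rewrite (_ : normc 0 = 0); last exact: normc0.
  by rewrite expr0n mul0r fine_ge0 ?sqsum_ge0.
have nl : normc l != 0 by apply: contra_neq l0 => /eq0_normc.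
rewrite -ler_pdivlMl ?exprn_even_gt0//.
have lK : l^-1 *: (l *: u) = u by rewrite scalerA mulVf// scale1r.
by have := ell2_normZ_le l^-1 (l *: u); rewrite lK normcV exprVn.
Qed.

Lemma ell2_normD u v : ell2_norm (u + v) <= ell2_norm u + ell2_norm v.
Proof.
have [->|u0] := eqVneq u 0.
  by rewrite add0r lerDr lecR sqrtr_ge0.
have [->|v0] := eqVneq v 0.
  by rewrite addr0 lerDl lecR sqrtr_ge0.
rewrite /ell2_norm -rmorphD/= lecR.
set a := Num.sqrt (fine (sqsum u)); set b := Num.sqrt (fine (sqsum v)).
have gt0 (w : ell2) : w != 0 -> 0 < Num.sqrt (fine (sqsum w)).
  move=> w0; rewrite lt_neqAle sqrtr_ge0 andbT eq_sym.
  by apply: contra_neq w0 => w0; apply: ell2_norm0_eq0; rewrite /ell2_norm w0.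
have a0 : 0 < a by exact: gt0.
have b0 : 0 < b by exact: gt0.
suff : fine (sqsum (u + v)) <= (a + b) ^+ 2.
  move=> /ler_wsqrtr; rewrite sqrtr_sqr ger0_norm// addr_ge0// ltW//.
have := sqsumD_le u v (divr_gt0 b0 a0).
rewrite -(fineK (sqsum_fin u)) -(fineK (sqsum_fin v)).
rewrite -(fineK (sqsum_fin (u + v))) -!EFinM -EFinD lee_fin => /le_trans; apply.
have sq (w : ell2) : fine (sqsum w) = Num.sqrt (fine (sqsum w)) ^+ 2.
  by rewrite sqr_sqrtr// fine_ge0// sqsum_ge0.
rewrite (sq u) (sq v) -/a -/b le_eqVlt; apply/orP; left; apply/eqP.
by field; rewrite !gt_eqF.
Qed.

HB.instance Definition _ := Lmodule_isNormed.Build R[i] ell2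
  ell2_normD ell2_normZ ell2_norm0_eq0.

End Ell2.

Section Operators.
Context (R : realType) (I : choiceType).
Local Notation H := (ell2 R I).
Implicit Types (T S : H -> H) (u v : H).

(* The sum of an absolutely summable family. *)
Definition rsum (a : I -> R) : R :=
  fine (\esum_(i in [set: I]) (a^\+ i)%:E) - fine (\esum_(i in [set: I]) (a^\- i)%:E).

Definition csum (a : I -> R[i]) : R[i] :=
  rsum (fun i => complex.Re (a i)) +i* rsum (fun i => complex.Im (a i)).

Definition inner u v : R[i] := csum (fun i => u i * conjc (v i)).

Definition basis_vec (i : I) : H := insubd 0 (fun j => (j == i)%:R).

(* Multiplication by a; [insubd] returns 0 on vectors u with a u not square
   summable, so for bounded a this is the usual everywhere-defined operator. *)
Definition mul_op (a : I -> R[i]) : H -> H := fun u => insubd 0 (fun i => a i * u i).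

Definition bounded_op T := linear T /\ continuous T.

Definition compact_op T := linear T /\ precompact (T @` [set u | `|u| <= 1]).

(* In the order of R[i], 0 <= z means that z is real and nonnegative. *)
Definition positive_op T := bounded_op T /\ forall u, 0 <= inner (T u) u.

(* phi(A), for a self-adjoint operator A, given by its graph, that has an
   orthonormal basis of eigenvectors: the bounded operator acting as phi(mu)
   on the eigenspace of A for mu. It is unique because the eigenvectors span a
   dense subspace. A may be unbounded, with domain {u | exists v, A u v}. *)
Definition spectral_fun (A : H -> H -> Prop) (phi : R -> R) : H -> H :=
  xget (fun=> 0) [set S | bounded_op S /\
    forall mu u, A u (mu%:C *: u) -> S u = (phi mu)%:C *: u].

(* T^s for T compact and positive, s > 0; note that 0 `^ s = 0. *)
Definition op_pow T (s : R) : H -> H :=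
  spectral_fun (fun u v => T u = v) (fun mu => mu `^ s).

(* Trace of a positive operator, in [0, +oo]. *)
Definition op_trace S : \bar R :=
  \esum_(i in [set: I]) (complex.Re (inner (S (basis_vec i)) (basis_vec i)))%:E.

(* v is an eigenvector of T^* T for t^2, i.e. of |T| for t (when t >= 0);
   the adjoint is written out weakly. *)
Definition abs_eigenvector T (t : R) v :=
  forall u, inner (T v) (T u) = (t ^+ 2)%:C * inner v u.

(* sigma_n(T), n = 0, 1, ...: the n-th largest eigenvalue of |T|, counted with
   multiplicity (0 if there is none): the largest t such that |T| has n + 1
   orthonormal eigenvectors with eigenvalues at least t. *)
Definition singular_value T (n : nat) : R :=
  sup [set t | 0 <= t /\ exists e : 'I_n.+1 -> H,
    (forall i j, inner (e i) (e j) = (i == j)%:R) /\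
    (forall i, exists2 t' : R, t <= t' & abs_eigenvector T t' (e i))].

Definition dixmier_macaev T := compact_op T /\
  (limn_esup (fun n => ((ln n%:R)^-1 *
     \sum_(1 <= j < n.+1) singular_value T j)%:E) < +oo)%E.

End Operators.

Section DixmierTrace.
Context (R : realType).
Implicit Types (a b : nat -> R[i]).

Definition bounded_seq a := exists M : R, forall n, normc (a n) <= M.

(* States on l^oo(N) that vanish on c_0 and are invariant under the dilations
   (a_n)_n |-> (a_(floor(n/m)))_n. Values of omega on unbounded sequences are
   irrelevant. *)
Definition generalized_limit (omega : (nat -> R[i]) -> R[i]) :=
  [/\ forall (z : R[i]) a b, bounded_seq a -> bounded_seq b ->
        omega (fun n => z * a n + b n) = z * omega a + omega b,
      forall a, bounded_seq a -> (forall n, 0 <= a n) -> 0 <= omega a,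
      omega (fun=> 1) = 1,
      forall a, (fun n => normc (a n)) @ \oo --> (0 : R) -> omega a = 0 &
      forall m a, (0 < m)%N -> bounded_seq a ->
        omega (fun n => a (n %/ m)%N) = omega a].

(* The Dixmier trace of a positive element T of the Dixmier-Macaev ideal. *)
Definition dixmier_trace (I : choiceType) (omega : (nat -> R[i]) -> R[i])
    (T : ell2 R I -> ell2 R I) : R[i] :=
  omega (fun n => ((ln (2 + n)%:R)^-1 * \sum_(0 <= j < n.+1) singular_value T j)%:C).

(* Measurability in the sense of Connes, for positive T, with common value c
   of the Dixmier traces. *)
Definition connes_measurable (I : choiceType) (T : ell2 R I -> ell2 R I) (c : R[i]) :=
  [/\ positive_op T, dixmier_macaev T &
      forall omega, generalized_limit omega -> dixmier_trace omega T = c].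

End DixmierTrace.

(* A k-graph. The composite [kcompose l m] is meaningful only if
   [ksrc l = krng m]; the vertices are the objects, identified with the
   morphisms of degree 0 through [kid]. *)
Record kgraph (k : nat) := KGraph {
  kobj : countType ;
  kmor : countType ;
  ksrc : kmor -> kobj ;
  krng : kmor -> kobj ;
  kid : kobj -> kmor ;
  kcompose : kmor -> kmor -> kmor ;
  ksrc_id : forall v, ksrc (kid v) = v ;
  krng_id : forall v, krng (kid v) = v ;
  ksrc_comp : forall l m, ksrc l = krng m -> ksrc (kcompose l m) = ksrc m ;
  krng_comp : forall l m, ksrc l = krng m -> krng (kcompose l m) = krng l ;
  kcomp_idl : forall l, kcompose (kid (krng l)) l = l ;
  kcomp_idr : forall l, kcompose l (kid (ksrc l)) = l ;
  kcompA : forall l m n, ksrc l = krng m -> ksrc m = krng n ->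
    kcompose l (kcompose m n) = kcompose (kcompose l m) n ;
  kdeg : kmor -> 'rV[nat]_k ;
  kdeg_id : forall v, kdeg (kid v) = 0 ;
  kdeg_comp : forall l m, ksrc l = krng m -> kdeg (kcompose l m) = kdeg l + kdeg m ;
  kfactor : forall l m n, kdeg l = m + n ->
    exists! p : kmor * kmor, [/\ kdeg p.1 = m, kdeg p.2 = n,
      ksrc p.1 = krng p.2 & l = kcompose p.1 p.2]
}.

Definition finite_kgraph k (L : kgraph k) :=
  forall n : 'rV[nat]_k, finite_set [set l : kmor L | kdeg l = n].

Definition strongly_connected k (L : kgraph k) :=
  forall v w : kobj L, exists l : kmor L, krng l = v /\ ksrc l = w.

Definition adj k (L : kgraph k) (i : 'I_k) (v w : kobj L) : nat :=
  #|` fset_set [set l : kmor L | [/\ kdeg l = delta_mx 0 i, krng l = v & ksrc l = w]]|%fset.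

Section SpectralRadius.
Context (R : realType) (V : choiceType) (A : V -> V -> nat).

(* Matrices are indexed by the (finite) set V itself. *)
Definition mx_eigenvalue (z : R[i]) := exists u : V -> R[i],
  (exists p, u p != 0) /\
  forall p, \sum_(q \in [set: V]) (A p q)%:R * u q = z * u p.

Definition spectral_radius : R := sup [set normc z | z in mx_eigenvalue].

End SpectralRadius.

Section PerronFrobenius.
Context (R : realType) (k : nat) (L : kgraph k).

Definition rho (i : 'I_k) : R := spectral_radius R (@adj k L i).

Definition is_pf_vector (x : kobj L -> R) :=
  [/\ forall v, 0 < x v,
      \sum_(v \in [set: kobj L]) x v = 1 &
      forall i v, \sum_(w \in [set: kobj L]) (adj i v w)%:R * x w = rho i * x v].

(* x^Lambda; it exists and is unique when L is finite and strongly connected. *)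
Definition pf_vector : kobj L -> R := xget (fun=> 0) is_pf_vector.

End PerronFrobenius.

(* For k-graphs with k >= 1, written k.+1 below. *)
Section Bratteli.
Context (R : realType) (k : nat) (L : kgraph k.+1).
Local Notation V := (kobj L).

(* The disjoint union of the edge sets. An edge is ((n, (p, q)), j) with
   j < A_i(p, q): it lies in E_(n+1), so it has range p in V_n and source q in
   V_(n+1). Counting colours from 0, that of E_(n+1) is n modulo k.+1. *)
Definition bedge := {t : nat * (V * V) & 'I_(adj (inZp t.1 : 'I_k.+1) t.2.1 t.2.2)}.
Definition blevel (e : bedge) : nat := (tag e).1.
Definition brng (e : bedge) : V := (tag e).2.1.
Definition bsrc (e : bedge) : V := (tag e).2.2.

Fixpoint valid_from (n : nat) (v : V) (s : seq bedge) : bool :=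
  if s is e :: s' then
    [&& blevel e == n, brng e == v & valid_from n.+1 (bsrc e) s']
  else true.

(* Finite paths starting in V_0, recorded with their range so that the paths
   of length 0 are the vertices. *)
Definition bpath := {p : V * seq bedge | valid_from 0 p.1 p.2}.
HB.instance Definition _ := Countable.on bpath.

Definition bpath_rng (g : bpath) : V := (val g).1.
Definition bpath_edges (g : bpath) : seq bedge := (val g).2.
Definition blength (g : bpath) : nat := size (bpath_edges g).
Definition bpath_src (g : bpath) : V := last (bpath_rng g) (map bsrc (bpath_edges g)).
Definition vertex_path (v : V) : bpath := exist _ (v, [::]) isT.

Definition proper_initial (h g : bpath) :=
  [/\ bpath_rng h = bpath_rng g, prefix (bpath_edges h) (bpath_edges g) & h != g].

(* The n-th edge of an infinite path, n = 0, 1, ..., lies in E_(n+1). *)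
Definition ipath :=
  {x : nat -> bedge | forall n, blevel (x n) = n /\ bsrc (x n) = brng (x n.+1)}.
Definition iedge (x : ipath) : nat -> bedge := proj1_sig x.

Definition initial_segment (g : bpath) (x : ipath) :=
  bpath_rng g = brng (iedge x 0) /\ bpath_edges g = mkseq (iedge x) (blength g).

Definition cylinder (g : bpath) : set ipath := [set x | initial_segment g x].

(* The longest common initial segment of x <> y, [None] if there is none. *)
Definition common_initial (x y : ipath) : option bpath :=
  xget None [set o | exists g, [/\ o = Some g, initial_segment g x,
    initial_segment g y & forall h, initial_segment h x -> initial_segment h y ->
      (blength h <= blength g)%N]].

Definition is_weight (w : bpath -> R) :=
  [/\ forall g, 0 < w g,
      \sum_(v \in [set: V]) w (vertex_path v) <= 1,
      ereal_sup [set (w g)%:E | g in [set g | blength g = n]] @[n --> \oo] --> 0%:E &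
      forall g h, proper_initial h g -> w g < w h].

Context (delta : R).

(* With |g| = q (k.+1) + t, colour i < t gets exponent q + 1, the others q. *)
Definition w_delta (g : bpath) : R :=
  (\prod_(i < k.+1)
     @rho R _ L i ^+ (blength g %/ k.+1 + (i < blength g %% k.+1))%N) `^ (- delta^-1)
  * @pf_vector R _ L (bpath_src g).

Definition d_delta (x y : ipath) : R :=
  if `[< x = y >] then 0
  else if common_initial x y is Some g then w_delta g else 1.

Definition diam (g : bpath) : R :=
  sup [set d_delta xy.1 xy.2 | xy in cylinder g `*` cylinder g].

Definition choice_function (tau : bpath -> ipath * ipath) :=
  forall g, [/\ cylinder g (tau g).1, cylinder g (tau g).2 &
    d_delta (tau g).1 (tau g).2 = diam g].

(* l^2(FB, C^2), with (g, true) and (g, false) indexing the two coordinates of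
   the g-summand, corresponding to tau_+ and tau_-. *)
Definition hilb := ell2 R (bpath * bool)%type.

(* A bounded operator for bounded f, in particular for f in C(X). *)
Definition pi_tau (tau : bpath -> ipath * ipath) (f : ipath -> R[i]) : hilb -> hilb :=
  mul_op (fun gb : bpath * bool => f (if gb.2 then (tau gb.1).1 else (tau gb.1).2)).

(* The graph of D, on its maximal domain {u | D u in l^2}. *)
Definition dirac_op (u v : hilb) : Prop :=
  forall g b, v (g, b) = ((diam g)^-1)%:C * u (g, ~~ b).

Definition abs_dirac_pow (p : R) : hilb -> hilb :=
  spectral_fun dirac_op (fun mu => `|mu| `^ p).

Definition char_fun (A : set ipath) (x : ipath) : R[i] := (`[< A x >])%:R.

End Bratteli.

(* Main.v *)
Require Import Defs.
From HB Require Import structures.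
From mathcomp Require Import all_boot all_order all_algebra.
From mathcomp Require Import complex finmap.
From mathcomp Require Import all_classical all_reals all_analysis.
From mathcomp Require Import zify ring lra.

(* The operator T is diagonal, with eigenvalue w_delta(g)^delta on both
   coordinates of each path g extending lambda, and 0 on all but finitely many
   other coordinates. Write rho for the product of the rho_i. For |g| = q k + t
   the eigenvalue is rho^-q times a factor that takes finitely many positive
   values, and, x^Lambda being an eigenvector of all the A_i, there are about
   rho^q paths of these lengths. The sum b_q of the eigenvalues over the paths
   with |g| in [q k, q k + k) is, for large q, a sum over t < k of linear
   functionals of the q-th power of U = A_(t+1) ... A_(t+k) / rho, indices
   modulo k; U fixes the positive vector x^Lambda, hence is power bounded, and
   the mean ergodic theorem gives b_0 + ... + b_(n-1) = beta n + O(1), with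
   beta > 0. Since the n-th block sits at position about rho^n in the list of
   singular values, their N-th partial sum is (beta / ln rho) ln N + O(1); and
   Abel summation with the ratio rho^-(s-1) gives the same limit beta / ln rho
   for (s - 1) Tr(T^s). *)

Set Implicit Arguments.
Unset Strict Implicit.
Unset Printing Implicit Defensive.

Import Order.TTheory GRing.Theory Num.Theory.
Import numFieldNormedType.Exports.
Import Normc.

Local Open Scope classical_set_scope.
Local Open Scope ring_scope.
Local Open Scope complex_scope.

(** Why averages: the eigenvalues carry x^Lambda raised to delta, which is in general no eigenvector
    of the adjacency matrices, so the b_q vary with q; a strongly connected graph may also be
    periodic, and then the powers of U need not converge. Only the partial sums of b settle down.
    Their error O(1) yields explicit two-sided bounds for the singular values and for the trace;
    both conclusions are derived from it separately, neither from the other. Why beta > 0: the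
    values of x^Lambda lie in (0, 1] and delta < 1, so the power delta dominates x^Lambda itself,
    and for x^Lambda the normalised sums over the extensions of lambda are constant and positive.
    What the weight gives: its positivity rules out the default value of [pf_vector], and its decay
    along long paths forces rho > 1, without which the blocks would have no geometric scale. An
    infinite path supplied by tau meets every colour, whence every rho_i > 0. *)

Lemma sumr_uniq_sub (R : realType) (I : eqType) (a : I -> R) (r s : seq I) :
  (forall i, 0 <= a i) -> uniq r -> uniq s -> {subset r <= s} ->
  \sum_(i <- r) a i <= \sum_(i <- s) a i.
Proof.
move=> a0 ur us rs; rewrite [leRHS](bigID (mem r))/= -[leLHS]addr0 lerD ?sumr_ge0//.
rewrite -[leRHS]big_filter le_eqVlt; apply/orP; left; apply/eqP.
apply: perm_big; apply: uniq_perm; rewrite ?filter_uniq// => i.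
by rewrite mem_filter; case: (boolP (i \in r)) => // /rs ->.
Qed.

(** * Unordered sums as suprema over duplicate-free lists *)

Section EsumSeq.
Context (R : realType) (I : choiceType).
Implicit Types (a : I -> R) (r : seq I).

Lemma esum_ge_seq a r : (forall i, 0 <= a i) -> uniq r ->
  ((\sum_(i <- r) a i)%:E <= \esum_(i in [set: I]) (a i)%:E)%E.
Proof.
move=> a0 ur; apply: esum_ge; exists [set` r].
  by split=> //; exact: finite_seq.
by rewrite -(fsbig_seq _ _ ur) sumEFin.
Qed.

Lemma esum_le_seq a (M : \bar R) :
  (forall r, uniq r -> ((\sum_(i <- r) a i)%:E <= M)%E) ->
  (\esum_(i in [set: I]) (a i)%:E <= M)%E.
Proof.
move=> H; apply: ge_ereal_sup => _ [F [finF _] <-].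
rewrite fsbig_finite// sumEFin; apply: H; exact: fset_uniq.
Qed.

Lemma esum_seq a r : (forall i, 0 <= a i) -> uniq r ->
  (forall i, i \notin r -> a i = 0) ->
  \esum_(i in [set: I]) (a i)%:E = (\sum_(i <- r) a i)%:E.
Proof.
move=> a0 ur ar; apply/eqP; rewrite eq_le esum_ge_seq// andbT.
apply: esum_le_seq => s us; rewrite lee_fin.
rewrite (bigID (mem r))/= [X in _ + X]big1 ?addr0// -big_filter.
apply: sumr_uniq_sub; rewrite ?filter_uniq// => i.
by rewrite mem_filter => /andP[].
Qed.

End EsumSeq.

(** * Diagonal operators on l^2 *)

Section Ell2Basics.
Context (R : realType) (I : choiceType).
Local Notation H := (ell2 R I).
Implicit Types (u v : H) (i j : I).

Lemma normc_ge0 (z : R[i]) : 0 <= normc z.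
Proof. by case: z => x y; exact: sqrtr_ge0. Qed.

Lemma complex_normE (z : R[i]) : `|z| = (normc z)%:C.
Proof. by case: z. Qed.

Lemma normc_real (x : R) : normc x%:C = `|x|.
Proof. by rewrite /= expr0n/= addr0 sqrtr_sqr. Qed.

Lemma normc_le_add (x y : R) : normc (x +i* y) <= `|x| + `|y|.
Proof.
rewrite /= -[leRHS]ger0_norm ?addr_ge0// -sqrtr_sqr ler_wsqrtr//.
rewrite sqrrD !real_normK ?num_real// lerD2r lerDl.
by rewrite mulrn_wge0// mulr_ge0.
Qed.

Lemma normc_dist (y z : R[i]) : `|normc y - normc z| <= normc (y - z).
Proof.
rewrite ler_norml lerNl opprB !lerBlDr -{1}[normc (y - z)]normcN opprB.
by have := le_normcD (z - y) y; have := le_normcD (y - z) z; rewrite !subrK => -> ->.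
Qed.

Lemma mulr_conjc_normc (z : R[i]) : z * conjc z = (normc z ^+ 2)%:C.
Proof.
case: z => x y; rewrite /= sqr_sqrtr ?addr_ge0 ?sqr_ge0//.
by apply/eqP; rewrite eq_complex/=; apply/andP; split; apply/eqP; ring.
Qed.

Lemma ell2P u v : (forall i, u i = v i) -> u = v.
Proof. by move=> uv; apply/val_inj/funext. Qed.

Lemma ell2D u v i : (u + v) i = u i + v i. Proof. by []. Qed.

Lemma ell2B u v i : (u - v) i = u i - v i. Proof. by []. Qed.

Lemma ell2Z (c : R[i]) u i : (c *: u) i = c * u i. Proof. by []. Qed.

Lemma ell2_fun_sum (J : Type) (r : seq J) (F : J -> H) i :
  (\sum_(j <- r) F j) i = \sum_(j <- r) F j i.
Proof. by elim/big_ind2: _ => // u x v y; rewrite /= => <- <-. Qed.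

Lemma sqsum_lty u : (sqsum u < +oo)%E.
Proof. by rewrite -ge0_fin_numE ?sqsum_ge0 ?sqsum_fin. Qed.

Lemma ell2_normE u : `|u| = (Num.sqrt (fine (sqsum u)))%:C.
Proof. by []. Qed.

Lemma ell2_norm_lt u (e : R) : 0 < e -> (sqsum u < (e ^+ 2)%:E)%E -> `|u| < e%:C.
Proof.
move=> e0 ue; rewrite ell2_normE ltcR -(gtr0_norm e0) -sqrtr_sqr ltr_sqrt ?exprn_gt0//.
by rewrite -lte_fin fineK ?sqsum_fin.
Qed.

Lemma ell2_norm_le1 u : `|u| <= 1 -> (sqsum u <= 1)%E.
Proof.
rewrite ell2_normE -[1 in X in X -> _]/(1%:C) lecR => u1.
rewrite -(fineK (sqsum_fin u)) lee_fin -[leLHS]sqr_sqrtr ?fine_ge0 ?sqsum_ge0//.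
by rewrite expr_le1// sqrtr_ge0.
Qed.

Lemma basis_vecE i j : basis_vec R i j = (j == i)%:R.
Proof.
rewrite /basis_vec /insubd insubT//; apply/square_summableP.
rewrite /sqsum (@esum_seq _ _ _ [:: i])// => [|k|k].
- by rewrite ltry.
- by rewrite sqr_ge0.
- by rewrite inE => /negbTE ->; rewrite normc0 expr0n.
Qed.

Definition bounded_entries (a : I -> R[i]) := exists M : R, forall i, normc (a i) <= M.

Lemma mul_op_sqsum (a u : I -> R[i]) (M : R) : 0 <= M ->
  (forall i, normc (a i) <= M) ->
  (sqsum (fun i => a i * u i)%R <= (M ^+ 2)%:E * sqsum u)%E.
Proof.
move=> M0 aM.
apply: (@le_trans _ _ (\esum_(i in [set: I]) (M ^+ 2 * normc (u i) ^+ 2)%:E)%E).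
  apply: le_esum => i _; rewrite lee_fin normcM exprMn.
  by rewrite ler_wpM2r ?sqr_ge0// ler_sqr ?nnegrE ?normc_ge0.
by apply: esumZ_le => [|i]; rewrite sqr_ge0.
Qed.

Lemma mul_opE (a : I -> R[i]) u i : bounded_entries a -> mul_op a u i = a i * u i.
Proof.
case=> M aM; rewrite /mul_op /insubd insubT//; apply/square_summableP.
have M0 : 0 <= M by apply: le_trans (aM i); exact: normc_ge0.
apply: le_lt_trans (mul_op_sqsum _ M0 aM) _.
by apply: lte_mul_pinfty; rewrite ?lee_fin ?sqr_ge0 ?sqsum_lty.
Qed.

Lemma mul_op_linear (a : I -> R[i]) : bounded_entries a -> linear (mul_op a).
Proof.
move=> ba c u v; apply: ell2P => i.
by rewrite ell2D ell2Z !mul_opE// ell2D ell2Z mulrDr mulrCA.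
Qed.

(** Norms on [ell2] take values in [R[i]], so the epsilons and radii of its topology are positive
    elements of [R[i]]. These are real, and the lemma brings them back to [R]. *)
Lemma complex_gt0P (z : R[i]) : 0 < z -> exists2 e : R, 0 < e & z = e%:C.
Proof. by case: z => x y; rewrite ltcE/= => /andP[/eqP-> ?]; exists x. Qed.

Lemma ell2_continuousP (T : H -> H) : continuous T <->
  forall u (e : R), 0 < e -> exists2 d : R, 0 < d &
    forall v, `|u - v| < d%:C -> `|T u - T v| < e%:C.
Proof.
split=> [cT u e e0|cT u].
  have /(@cvgrPdist_lt _ H H (nbhs u) (nbhs_filter u)) := cT u.
  move=> /(_ e%:C); rewrite ltcR => /(_ e0)/nbhs_ballP[/= _ /complex_gt0P[d d0 ->]] dT.
  by exists d => // v uv; apply: dT; rewrite -ball_normE.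
apply/(@cvgrPdist_lt _ H H (nbhs u) (nbhs_filter u)) => _ /complex_gt0P[e e0 ->].
have [d d0 dT] := cT u e e0.
apply/nbhs_ballP; exists d%:C => [|v]; first by rewrite /= ltcR.
by rewrite -ball_normE => /dT.
Qed.

Lemma mul_op_continuous (a : I -> R[i]) : bounded_entries a -> continuous (mul_op a).
Proof.
move=> ba; have := ba => -[M aM].
have M1 : 0 < `|M| + 1 by rewrite ltr_wpDl.
have {}aM i : normc (a i) <= `|M| + 1.
  by apply: le_trans (aM i) _; rewrite (le_trans (ler_norm _))// lerDl.
apply/ell2_continuousP => u e e0; exists (e / (`|M| + 1)); first by rewrite divr_gt0.
move=> v uv.
have -> : mul_op a u - mul_op a v = mul_op a (u - v).
  by apply: ell2P => i; rewrite ell2B !mul_opE// ell2B mulrBr.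
apply: ell2_norm_lt => //.
rewrite (_ : sqsum _ = sqsum (fun i => a i * (u - v) i)); last first.
  by rewrite /sqsum; apply: eq_esum => i _; rewrite mul_opE.
apply: le_lt_trans (mul_op_sqsum _ (ltW M1) aM) _.
rewrite -(fineK (sqsum_fin (u - v))) -EFinM lte_fin.
move: uv; rewrite ell2_normE ltcR => uv.
rewrite -[X in _ * X]sqr_sqrtr ?fine_ge0 ?sqsum_ge0// -exprMn.
rewrite ltr_sqr ?nnegrE ?mulr_ge0 ?sqrtr_ge0 ?ltW//.
by rewrite mulrC -ltr_pdivlMr.
Qed.

Lemma mul_op_bounded (a : I -> R[i]) : bounded_entries a -> bounded_op (mul_op a).
Proof. by move=> ba; split; [exact: mul_op_linear | exact: mul_op_continuous]. Qed.

Lemma mul_op_basis (a : I -> R[i]) i : bounded_entries a ->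
  mul_op a (basis_vec R i) = a i *: basis_vec R i.
Proof.
move=> ba; apply: ell2P => j; rewrite ell2Z mul_opE// !basis_vecE.
by case: eqP => [->//|_]; rewrite !mulr0.
Qed.

Lemma mul_op_comp (a b : I -> R[i]) : bounded_entries a -> bounded_entries b ->
  mul_op a \o mul_op b = mul_op (fun i => a i * b i).
Proof.
move=> ba bb; apply/funext => u; apply: ell2P => i.
rewrite /= !mul_opE// ?mulrA//.
case: ba bb => M aM [N bN]; exists (M * N) => j; rewrite normcM.
by rewrite ler_pM ?normc_ge0.
Qed.

(* Finite truncations of u converge to u. *)
Lemma bounded_op_ext (S S' : H -> H) : bounded_op S -> bounded_op S' ->
  (forall i, S (basis_vec R i) = S' (basis_vec R i)) -> S = S'.
Proof.
move=> [linS cS] [linS' cS'] SS'; apply/funext => u; apply/eqP.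
rewrite -subr_eq0 -normr_le0; apply/ler_addgt0Pl => _ /complex_gt0P[e e0 ->].
have e2 : 0 < e / 2 by rewrite divr_gt0.
have S0 : S 0 - S' 0 = 0.
  have z (T : H -> H) : linear T -> T 0 = 0.
    by move=> lT; have := lT (-1) 0 0; rewrite scaler0 addr0 scaleN1r addNr.
  by rewrite (z S)// (z S')// subrr.
have DB c v w : S (c *: v + w) - S' (c *: v + w) =
    c *: (S v - S' v) + (S w - S' w).
  by rewrite linS linS' scalerBr opprD addrACA.
have Dsum (r : seq I) (f : I -> R[i]) :
    S (\sum_(i <- r) f i *: basis_vec R i) - S' (\sum_(i <- r) f i *: basis_vec R i) = 0.
  elim: r => [|i r IH]; first by rewrite big_nil.
  by rewrite big_cons DB IH addr0 SS' subrr scaler0.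
have /ell2_continuousP/(_ 0 _ e2)[d1 d10 d1S] := cS.
have /ell2_continuousP/(_ 0 _ e2)[d2 d20 d2S] := cS'.
pose d := Num.min d1 d2.
have d0 : 0 < d by rewrite lt_min d10.
have dD v : `|v| < d%:C -> `|S v - S' v| < e%:C.
  move=> vd; rewrite (_ : S v - S' v = (S' 0 - S' v) - (S 0 - S v)); last first.
    have -> : S 0 = S' 0 by apply/eqP; rewrite -subr_eq0 S0.
    by rewrite opprB [RHS]addrC addrA subrK.
  apply: (le_lt_trans (ler_normB _ _)).
  have -> : e%:C = (e / 2)%:C + (e / 2)%:C by rewrite -rmorphD/= -splitr.
  by apply: ltrD; [apply: d2S|apply: d1S]; rewrite sub0r normrN;
    rewrite (lt_le_trans vd)// lecR ge_min lexx ?orbT.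
(* [sqsum u] is a supremum of finite sums, so some finite [r] leaves a tail of squared norm below
   [d ^+ 2]. *)
have [r ur ru] : exists2 r, uniq r & fine (sqsum u) - d ^+ 2 < \sum_(i <- r) normc (u i) ^+ 2.
  apply: contrapT => nr.
  have : (sqsum u <= (fine (sqsum u) - d ^+ 2)%:E)%E.
    apply: esum_le_seq => r ur; rewrite lee_fin leNgt; apply/negP => ru.
    by apply: nr; exists r.
  rewrite -[leLHS](fineK (sqsum_fin u)) lee_fin lerBrDr gerDl leNgt.
  by rewrite exprn_gt0.
pose w := \sum_(i <- r) u i *: basis_vec R i.
have wE i : w i = if i \in r then u i else 0.
  rewrite ell2_fun_sum; under eq_bigr do rewrite ell2Z basis_vecE.
  case: ifPn => ir.
    rewrite (bigD1_seq i)//= eqxx mulr1 big1 ?addr0// => j ji.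
    by rewrite eq_sym (negbTE ji) mulr0.
  rewrite big_seq big1// => j jr /=.
  by rewrite (_ : (i == j) = false) ?mulr0//; apply: contraNF ir => /eqP->.
have -> : S u - S' u = S (u - w) - S' (u - w).
  by have := DB 1 (u - w) w; rewrite !scale1r subrK Dsum addr0.
rewrite addr0; apply: ltW; apply: dD.
apply: ell2_norm_lt => //.
rewrite (le_lt_trans (y := (fine (sqsum u) - \sum_(i <- r) normc (u i) ^+ 2)%:E))//.
  rewrite /sqsum (eq_esum (b := fun i => (if i \in r then 0 else normc (u i) ^+ 2)%:E)).
    apply: esum_le_seq => s us; rewrite lee_fin lerBrDr.
    rewrite -lee_fin fineK ?sqsum_fin//.
    rewrite (bigID (mem r))/= [X in X + _ + _]big1 ?add0r; last by move=> i ->.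
    rewrite (eq_bigr (fun i => normc (u i) ^+ 2)); last by move=> i /negbTE ->.
    rewrite -big_filter -big_cat; apply: esum_ge_seq => [i|]; first by rewrite sqr_ge0.
    rewrite cat_uniq filter_uniq// ur andbT; apply/hasPn => i ir /=.
    by rewrite mem_filter ir.
  move=> i _; rewrite ell2B wE; case: ifP => _; last by rewrite subr0.
  by rewrite subrr normc0 expr0n.
by rewrite lte_fin ltrBlDr -ltrBlDl.
Qed.

(** The second hypothesis confines an eigenvector for [mu] to coordinates where [b] equals [phi mu],
    so the multiplication operator is a candidate for [spectral_fun]. The third makes every basis
    vector a finite sum of eigenvectors, so any two candidates agree on the basis, and
    [bounded_op_ext] identifies them. *)
Lemma spectral_funE (A : H -> H -> Prop) (phi : R -> R) (b : I -> R) :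
  bounded_entries (fun i => (b i)%:C) ->
  (forall mu u i, A u (mu%:C *: u) -> u i != 0 -> phi mu = b i) ->
  (forall i, exists r : seq (R * H), (forall p, p \in r -> A p.2 (p.1%:C *: p.2)) /\
    basis_vec R i = \sum_(p <- r) p.2) ->
  spectral_fun A phi = mul_op (fun i => (b i)%:C).
Proof.
move=> bb Aphi Abasis.
have bS : [set S | bounded_op S /\ forall mu u, A u (mu%:C *: u) -> S u = (phi mu)%:C *: u]
    (mul_op (fun i => (b i)%:C)).
  split; first exact: mul_op_bounded.
  move=> mu u Au; apply: ell2P => i; rewrite mul_opE// ell2Z.
  by have [->|ui] := eqVneq (u i) 0; rewrite ?mulr0// (Aphi _ _ _ Au ui).
rewrite /spectral_fun; case: xgetP => [S _ [bdS SA]|/(_ _ bS)//].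
have [bdM MA] := bS.
apply: bounded_op_ext => // i; have [r [rA ->]] := Abasis i.
have [linS _] := bdS; have [linM _] := bdM.
have lsum (T : H -> H) : linear T -> T (\sum_(p <- r) p.2) = \sum_(p <- r) T p.2.
  move=> lT; elim: (r) => [|p r' IH].
    by rewrite !big_nil; have := lT (-1) 0 0; rewrite scaler0 addr0 scaleN1r addNr.
  by rewrite !big_cons -IH -[p.2]scale1r lT !scale1r.
rewrite !lsum// !big_seq; apply: eq_bigr => p pr.
by rewrite (SA _ _ (rA _ pr)) (MA _ _ (rA _ pr)).
Qed.

End Ell2Basics.

(** * Compactness of diagonal operators *)

Section Compactness.
Context (R : realType) (I : choiceType).
Local Notation H := (ell2 R I).

(** Provides the factor for Tychonoff's theorem: a square contains the unit disc and is the image of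
    a product of two segments. *)
Lemma complex_square_compact :
  compact [set z : R[i]^o | `|complex.Re z| <= 1 /\ `|complex.Im z| <= 1].
Proof.
pose f (p : R * R) : R[i]^o := p.1 +i* p.2.
have -> : [set z : R[i]^o | `|complex.Re z| <= 1 /\ `|complex.Im z| <= 1] =
    f @` (`[-1, 1]%classic `*` `[-1, 1]%classic).
  apply/seteqP; split=> [[x y]/= [x1 y1]|_ [[x y] /= + <-]/=].
    by exists (x, y) => //; rewrite /= !in_itv/= -!ler_norml.
  by rewrite !in_itv/= -!ler_norml => -[].
apply: continuous_compact; last by apply: compact_setX; exact: segment_compact.
apply: continuous_subspaceT => p.
apply/(@cvgrPdist_lt _ R[i]^o) => _ /complex_gt0P[e e0 ->].
have e2 : 0 < e / 2 by rewrite divr_gt0.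
exists (ball p.1 (e / 2), ball p.2 (e / 2)); first by split; exact: nbhsx_ballx.
move=> q /=; rewrite -!ball_normE/= => -[pq1 pq2].
rewrite [X in X < _](complex_normE (f p - f q)) ltcR /f/= [ltRHS]splitr.
exact: le_lt_trans (normc_le_add _ _) (ltrD pq1 pq2).
Qed.

Lemma ptws_normc_continuous (c : R[i]) (i : I) :
  continuous (fun f : {ptws I -> R[i]^o} => normc (f i - c)).
Proof.
move=> f; apply: (@cvg_comp _ _ _ (@proj I (fun=> R[i]^o) i) (fun z => normc (z - c))).
  exact: proj_continuous.
apply/(@cvgrPdist_lt _ R) => e e0.
apply/nbhs_ballP; exists e%:C => [|z]; first by rewrite /= ltcR.
rewrite -ball_normE/= [X in X < _](complex_normE (f i - z)) ltcR; apply: le_lt_trans.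
by have := normc_dist (f i - c) (z - c); rewrite opprB addrA subrK.
Qed.

Lemma ptws_sum_normc_continuous (c : I -> R[i]) (r : seq I) :
  continuous (fun f : {ptws I -> R[i]^o} => \sum_(i <- r) normc (f i - c i) ^+ 2).
Proof.
move=> f; elim: r => [|i r IH].
  have -> : (fun g : {ptws I -> R[i]^o} => \sum_(i <- [::]) normc (g i - c i) ^+ 2) = cst 0.
    by apply/funext => g; rewrite big_nil.
  exact: cst_continuous.
have -> : (fun g : {ptws I -> R[i]^o} => \sum_(i <- i :: r) normc (g i - c i) ^+ 2) =
    fun g => normc (g i - c i) * normc (g i - c i) + \sum_(i <- r) normc (g i - c i) ^+ 2.
  by apply/funext => g; rewrite big_cons.
by apply: continuousD IH; apply: continuousM; exact: ptws_normc_continuous.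
Qed.

(** The ball lies in a product of compact squares. It is closed for pointwise convergence because
    its condition is an intersection of closed conditions, each on finitely many coordinates. *)
Lemma sqsum_ball_compact : compact [set f : {ptws I -> R[i]^o} | (sqsum f <= 1)%E].
Proof.
have HT := @tychonoff I (fun=> R[i]^o) _ (fun _ => complex_square_compact).
apply: subclosed_compact HT _ => [|f /= f1 i].
  rewrite (_ : mkset _ = \bigcap_(r in [set r : seq I | uniq r])
      [set f : {ptws I -> R[i]^o} | \sum_(i <- r) normc (f i - 0) ^+ 2 <= 1]).
    apply: closed_bigI => r _.
    apply: (@closed_comp _ _ (fun f : {ptws I -> R[i]^o} => \sum_(i <- r) normc (f i - 0) ^+ 2)
       [set x : R | x <= 1]) (@closed_le R 1).
    by move=> f _; exact: (@ptws_sum_normc_continuous (fun=> 0) r f).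
  apply/seteqP; split=> f /= f1.
    move=> r /= ur; rewrite -lee_fin; apply: le_trans f1.
    under eq_bigr do rewrite subr0.
    by apply: esum_ge_seq => // i; rewrite sqr_ge0.
  apply: esum_le_seq => r ur; rewrite lee_fin; have := f1 r ur => /=.
  by under eq_bigr do rewrite subr0.
have fi1 : normc (f i) ^+ 2 <= 1.
  rewrite -lee_fin; apply: le_trans f1.
  have := @esum_ge_seq _ _ (fun i => normc (f i) ^+ 2) [:: i] (fun=> sqr_ge0 _) isT.
  by rewrite big_seq1.
have xy (x y : R) : x ^+ 2 + y ^+ 2 <= 1 -> `|x| <= 1.
  move=> H1; rewrite -(@expr_le1 _ 2)// real_normK ?num_real//.
  by apply: le_trans H1; rewrite lerDl sqr_ge0.
move: fi1; case: (f i) => x y /=.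
rewrite sqr_sqrtr ?addr_ge0 ?sqr_ge0// => H1; split; first exact: xy H1.
by apply: xy (_ : _ + x ^+ 2 <= 1); rewrite addrC.
Qed.

(** On the unit ball with pointwise convergence, which is compact, multiplication by a family
    vanishing at infinity is continuous into the norm topology: finitely many coordinates are
    controlled by pointwise convergence, the others by the small entries. So the image of the ball
    lies in a compact set. *)
Lemma mul_op_compact (a : I -> R[i]) :
  (forall e : R, 0 < e -> exists r : seq I, forall i, i \notin r -> normc (a i) <= e) ->
  bounded_entries a -> compact_op (mul_op a).
Proof.
move=> a0 ba; split; first exact: mul_op_linear.
have [M aM] := ba.
pose C := [set f : {ptws I -> R[i]^o} | (sqsum f <= 1)%E].
pose G (f : {ptws I -> R[i]^o}) : H := insubd 0 (fun i => a i * f i).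
have M1 : 0 < `|M| + 1 by rewrite ltr_wpDl.
have {}aM i : normc (a i) <= `|M| + 1.
  by apply: le_trans (aM i) _; rewrite (le_trans (ler_norm _))// lerDl.
have GE f i : C f -> G f i = a i * f i.
  move=> Cf; rewrite /G /insubd insubT//; apply/square_summableP.
  apply: le_lt_trans (mul_op_sqsum _ (ltW M1) aM) _.
  by apply: lte_mul_pinfty; rewrite ?lee_fin ?sqr_ge0// (le_lt_trans Cf)// ltry.
have GC : {within C, continuous G}.
  apply/subspace_continuousP => f Cf.
  apply/(@cvgrPdist_lt _ H) => _ /complex_gt0P[e e0 ->].
  (* Two points of the ball differ by at most 4 in squared norm, so entries at most [e / 4]
     contribute at most [e ^+ 2 / 4]; the coordinates in [r] will contribute less than
     [e ^+ 2 / 2]. *)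
  have e4 : 0 < e / 4 by rewrite divr_gt0.
  have [r0 ra0] := a0 _ e4.
  pose r := undup r0; have ur : uniq r by exact: undup_uniq.
  have ra i : i \notin r -> normc (a i) <= e / 4 by rewrite mem_undup => /ra0.
  pose N := `|M| + 1.
  have N0 : 0 < (e / N) ^+ 2 / 2 by rewrite divr_gt0 ?exprn_gt0 ?divr_gt0.
  rewrite near_withinE.
  have /(@cvgrPdist_lt _ R)/(_ _ N0) := @ptws_sum_normc_continuous f r f.
  apply: filterS => g; rewrite big1 => [|i _]; last by rewrite subrr normc0 expr0n.
  rewrite sub0r normrN ger0_norm ?sumr_ge0// => [gf Cg|i _]; last by rewrite sqr_ge0.
  apply: ell2_norm_lt => //.
  have -> : sqsum (G f - G g) = sqsum (fun i => a i * (f i - g i)).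
    by apply: eq_esum => i _; rewrite ell2B !GE// mulrBr.
  have fg4 : (sqsum (fun i => f i - g i)%R <= 4%:E)%E.
    apply: le_trans (sqsumD_le f (fun i => - g i) (@ltr01 R)) _.
    have -> : sqsum (fun i => - g i) = sqsum g.
      by apply: eq_esum => i _; rewrite normcN.
    rewrite invr1 [leRHS](_ : _ = ((1 + 1)%:E * 1%:E + (1 + 1)%:E * 1%:E)%E).
      by apply: leeD; apply: lee_wpmul2l; rewrite ?lee_fin.
    by rewrite -!EFinM -EFinD; congr EFin; ring.
  pose d i := normc (f i - g i) ^+ 2.
  have d0 i : 0 <= d i by rewrite sqr_ge0.
  apply: (@le_lt_trans _ _ (\esum_(i in [set: I])
     ((if i \in r then N ^+ 2 * d i else 0)%:E + ((e / 4) ^+ 2 * d i)%:E))%E).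
    apply: le_esum => i _; rewrite -EFinD lee_fin normcM exprMn.
    case: ifPn => ir.
      apply: ler_wpDr; first by rewrite mulr_ge0 ?sqr_ge0.
      apply: ler_wpM2r; first exact: sqr_ge0.
      by rewrite ler_sqr ?nnegrE ?normc_ge0// ltW.
    rewrite add0r; apply: ler_wpM2r; first exact: sqr_ge0.
    by rewrite ler_sqr ?nnegrE ?normc_ge0 ?ra// ltW.
  rewrite esumD; last 2 first.
  - by move=> i _; rewrite lee_fin; case: ifP => // _; rewrite mulr_ge0 ?sqr_ge0.
  - by move=> i _; rewrite lee_fin mulr_ge0 ?sqr_ge0.
  rewrite (@esum_seq _ _ _ r)//; last 2 first.
  - by move=> i; case: ifP => // _; rewrite mulr_ge0 ?sqr_ge0.
  - by move=> i /negbTE->.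
  rewrite big_seq (eq_bigr (fun i => N ^+ 2 * d i)); last by move=> i ->.
  rewrite -big_seq -mulr_sumr.
  apply: (@le_lt_trans _ _ ((N ^+ 2 * \sum_(i <- r) d i)%:E + ((e / 4) ^+ 2)%:E * 4%:E)%E).
    apply: leeD => //; apply: le_trans (esumZ_le _ _) _; rewrite ?sqr_ge0//.
    by apply: lee_wpmul2l => //; rewrite lee_fin sqr_ge0.
  rewrite -EFinM -EFinD lte_fin.
  have {}gf : \sum_(i <- r) d i < (e / N) ^+ 2 / 2.
    apply: le_lt_trans gf; apply: ler_sum => i _.
    by rewrite /d -normcN opprB.
  have N2 : 0 < N ^+ 2 by rewrite exprn_gt0.
  have H1 : N ^+ 2 * \sum_(i <- r) d i < e ^+ 2 / 2.
    rewrite -ltr_pdivlMl//; apply: (lt_le_trans gf).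
    by rewrite le_eqVlt; apply/orP; left; apply/eqP; field; rewrite gt_eqF.
  have H2 : (e / 4) ^+ 2 * 4 = e ^+ 2 / 4 by field.
  have := exprn_gt0 2 e0.
  by rewrite H2; lra.
apply: (@precompact_subset _ _ (G @` C)); last first.
  apply: compact_precompact; first exact: norm_hausdorff.
  exact: continuous_compact sqsum_ball_compact.
move=> _ [u /= u1 <-]; exists (u : I -> R[i]) => //.
exact: ell2_norm_le1.
Qed.

End Compactness.

(** * Singular values and trace of a diagonal operator *)

Section Inner.
Context (R : realType) (I : choiceType).
Local Notation H := (ell2 R I).
Implicit Types (u v : H) (i j : I).

Lemma rsum_seq (f : I -> R) (r : seq I) : uniq r -> (forall i, i \notin r -> f i = 0) ->
  rsum f = \sum_(i <- r) f i.
Proof.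
move=> ur fr; rewrite /rsum (@esum_seq _ _ f^\+ r) ?(@esum_seq _ _ f^\- r)//=.
- by rewrite -sumrB; apply: eq_bigr => i _; rewrite -[in RHS](funrposBneg f).
- by move=> i /fr fi0; rewrite /funrneg fi0 oppr0 maxxx.
- by move=> i /fr fi0; rewrite /funrpos fi0 maxxx.
Qed.

Lemma csum_seq (f : I -> R[i]) (r : seq I) : uniq r -> (forall i, i \notin r -> f i = 0) ->
  csum f = \sum_(i <- r) f i.
Proof.
move=> ur fr; rewrite /csum !(@rsum_seq _ r)//; last 2 first.
- by move=> i /fr ->.
- by move=> i /fr ->.
elim: (r) => [|i r' IH]; first by rewrite !big_nil.
by rewrite !big_cons -IH; case: (f i).
Qed.

Lemma inner_basisr u i : inner u (basis_vec R i) = u i.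
Proof.
rewrite /inner (@csum_seq _ [:: i])//; first by rewrite big_seq1 basis_vecE eqxx conjc1 mulr1.
by move=> j; rewrite inE basis_vecE => /negbTE->; rewrite conjc0 mulr0.
Qed.

Lemma inner_basisl u i : inner (basis_vec R i) u = conjc (u i).
Proof.
rewrite /inner (@csum_seq _ [:: i])//; first by rewrite big_seq1 basis_vecE eqxx mul1r.
by move=> j; rewrite inE basis_vecE => /negbTE->; rewrite mul0r.
Qed.

Lemma innerZr (c : R[i]) u i : inner u (c *: basis_vec R i) = conjc c * u i.
Proof.
rewrite /inner (@csum_seq _ [:: i])//.
  by rewrite big_seq1 ell2Z basis_vecE eqxx mulr1 mulrC.
by move=> j; rewrite inE ell2Z basis_vecE => /negbTE->; rewrite mulr0 conjc0 mulr0.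
Qed.

Lemma innerZl (c : R[i]) u i : inner (c *: basis_vec R i) u = c * conjc (u i).
Proof.
rewrite /inner (@csum_seq _ [:: i])//.
  by rewrite big_seq1 ell2Z basis_vecE eqxx mulr1.
by move=> j; rewrite inE ell2Z basis_vecE => /negbTE->; rewrite mulr0 mul0r.
Qed.

Lemma inner_basis i j : inner (basis_vec R i) (basis_vec R j) = (i == j)%:R.
Proof. by rewrite inner_basisr basis_vecE eq_sym. Qed.

(** Orthonormality says that the coordinate matrix times its conjugate transpose is the identity of
    size [m], and this product factors through dimension [size r]. *)
Lemma orthonormal_size m (e : 'I_m -> H) (r : seq I) : uniq r ->
  (forall k i, i \notin r -> e k i = 0) ->
  (forall k l, inner (e k) (e l) = (k == l)%:R) -> (m <= size r)%N.
Proof.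
move=> ur er orth.
pose E := \matrix_(k < m, l < size r) e k (tnth (in_tuple r) l).
pose E' := \matrix_(l < size r, k < m) conjc (e k (tnth (in_tuple r) l)).
apply: (@mulmx1_min _ _ _ E E').
apply/matrixP => k l; rewrite !mxE -orth /inner (@csum_seq _ r)//.
  by rewrite [RHS]big_tnth; apply: eq_bigr => p _; rewrite !mxE.
by move=> i /er ->; rewrite mul0r.
Qed.

End Inner.

Section DiagonalOperator.
Context (R : realType) (I : choiceType) (a : I -> R).
Hypothesis a_ge0 : forall i, 0 <= a i.
Hypothesis a_bnd : exists M : R, forall i, a i <= M.
Local Notation H := (ell2 R I).
Local Notation T := (mul_op (fun i => (a i)%:C)).

Lemma diag_bounded_entries : bounded_entries (fun i => (a i)%:C).
Proof. by case: a_bnd => M aM; exists M => i; rewrite normc_real ger0_norm. Qed.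
Let ba := diag_bounded_entries.

Lemma diag_positive : positive_op T.
Proof.
split; first exact: mul_op_bounded.
move=> u; rewrite /inner (_ : (fun i => _) = fun i => (a i * normc (u i) ^+ 2)%:C).
  rewrite /csum /= lecE /= /rsum /=; apply/andP; split.
    by rewrite !esum1/= ?subr0// => i _; rewrite /funrneg /funrpos ?oppr0 maxxx.
  rewrite [X in _ - fine X]esum1 ?subr0.
    apply: fine_ge0; apply: esum_ge0 => i _; rewrite lee_fin; exact: funrpos_ge0.
  move=> i _; rewrite /funrneg; congr EFin; apply/max_idPr.
  by rewrite oppr_le0 mulr_ge0 ?sqr_ge0.
by apply/funext => i; rewrite mul_opE// -mulrA mulr_conjc_normc -rmorphM.
Qed.

Lemma diag_trace : op_trace T = \esum_(i in [set: I]) (a i)%:E.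
Proof.
by apply: eq_esum => i _; rewrite inner_basisr mul_opE// basis_vecE eqxx mulr1.
Qed.

(** Tested against the basis vector [i], the eigenvector equation reads a_i^2 v_i = t^2 v_i. *)
Lemma diag_abs_eigenvector t v i : 0 <= t -> abs_eigenvector T t v -> v i != 0 -> a i = t.
Proof.
move=> t0 /(_ (basis_vec R i)); rewrite mul_op_basis// innerZr inner_basisr mul_opE//.
rewrite mulrA conjc_real -rmorphM/= => E vi.
have /mulIf/(_ _ _ E)/eqP := vi.
by rewrite -expr2 eq_complex/= eqxx andbT eqrXn2// => /eqP.
Qed.

Lemma diag_abs_eigenvector_basis i : abs_eigenvector T (a i) (basis_vec R i).
Proof.
move=> u; rewrite mul_op_basis// innerZl inner_basisl mul_opE// rmorphM/= oppr0.
by rewrite mulrA -rmorphM/= -expr2.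
Qed.

Local Notation sv_set n := [set t | 0 <= t /\ exists e : 'I_n.+1 -> H,
    (forall i j, inner (e i) (e j) = (i == j)%:R) /\
    (forall i, exists2 t' : R, t <= t' & abs_eigenvector T t' (e i))].

(** Eigenvectors of |T| for values at least [t] vanish outside [r], so [n.+1] orthonormal ones live
    in a space of dimension [size r]. *)
Lemma sv_set_support n t (r : seq I) : uniq r -> (forall i, t <= a i -> i \in r) ->
  (sv_set n) t -> (n < size r)%N.
Proof.
move=> ur tr [t0 [e [orth ev]]]; apply: (orthonormal_size (e := e)) => // k i.
apply: contraNeq => eki; apply: tr; have [t' tt' ev'] := ev k.
by rewrite (diag_abs_eigenvector (le_trans t0 tt') ev' eki).
Qed.

Lemma sv_set_bounded n : has_ubound (sv_set n).
Proof.
have [M aM] := a_bnd; exists M => t tn; rewrite leNgt; apply/negP => Mt.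
(* Above the bound [M] no coordinate can carry an eigenvector, so the empty list serves as
   support. *)
suff : (n < size (Nil I))%N by [].
apply: sv_set_support tn => // i ti.
by have := lt_le_trans Mt ti; rewrite ltNge aM.
Qed.

Lemma singular_value_ge n t (s : seq I) : uniq s -> size s = n.+1 -> 0 <= t ->
  (forall i, i \in s -> t <= a i) -> t <= singular_value T n.
Proof.
move=> us sn t0 ts; apply: (ub_le_sup (@sv_set_bounded n)); split=> //.
pose x (k : 'I_n.+1) := tnth (in_tuple s) (cast_ord (esym sn) k).
have xs k : x k \in s by exact: mem_tnth.
exists (fun k => basis_vec R (x k)); split=> [k l|k].
  rewrite inner_basis; congr (_%:R); congr nat_of_bool.
  rewrite /x !(tnth_nth (x k)) /= nth_uniq ?sn//.
by exists (a (x k)); [exact/ts/xs | exact: diag_abs_eigenvector_basis].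
Qed.

Lemma singular_value_le n (e : R) (r : seq I) : 0 <= e -> uniq r -> (size r <= n)%N ->
  (forall i, i \notin r -> a i <= e) -> singular_value T n <= e.
Proof.
move=> e0 ur rn re; rewrite /singular_value.
have [->|/set0P ne] := eqVneq (sv_set n) set0; first by rewrite sup0.
apply: ge_sup => // t tn; rewrite leNgt; apply/negP => et.
have : (n < size r)%N.
  apply: (sv_set_support ur) tn => i ti; apply: contraT => /re.
  by rewrite leNgt (lt_le_trans et).
by rewrite ltnNge rn.
Qed.

Lemma singular_value_ge0 n : 0 <= singular_value T n.
Proof.
rewrite /singular_value; have [->|/set0P[t tn]] := eqVneq (sv_set n) set0.
  by rewrite sup0.
by apply: le_trans (ub_le_sup (@sv_set_bounded n) tn); case: tn.
Qed.

Let gea : rel I := fun i j => a j <= a i.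

Lemma sum_nth_le (l : seq R) n : (forall x, x \in l -> 0 <= x) ->
  \sum_(j < n) nth 0 l j <= \sum_(x <- l) x.
Proof.
elim: l n => [|x l IH] n l0.
  by rewrite big_nil big1// => j _; rewrite nth_nil.
have x0 : 0 <= x by apply: l0; rewrite mem_head.
have {}l0 y : y \in l -> 0 <= y by move=> yl; apply: l0; rewrite in_cons yl orbT.
rewrite big_cons; case: n => [|n].
  by rewrite big_ord0 addr_ge0// big_seq sumr_ge0.
by rewrite big_ord_recl lerD2l/=; exact: IH.
Qed.

(** With [r] sorted decreasingly into [s], every entry outside the first [j] members of [s] is at
    most a(s_j) + e, either by the order or by the cutoff [e]; hence so is the [j]-th singular
    value. Past the end of [s] the cutoff alone remains. *)
Lemma sum_singular_value_le (e : R) (r : seq I) n : 0 <= e -> uniq r ->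
  (forall i, i \notin r -> a i <= e) ->
  \sum_(j < n) singular_value T j <= \sum_(i <- r) a i + e *+ n.
Proof.
move=> e0 ur re; pose s := sort gea r.
have us : uniq s by rewrite sort_uniq.
have sorted_s : sorted gea s by apply: sort_sorted => i j; exact: le_total.
have -> : \sum_(i <- r) a i = \sum_(x <- map a s) x.
  by rewrite big_map; apply: perm_big; rewrite perm_sym perm_sort.
apply: (@le_trans _ _ (\sum_(j < n) nth 0 (map a s) j + \sum_(j < n) e)); last first.
  rewrite sumr_const card_ord lerD2r; apply: sum_nth_le => x /mapP[i _ ->].
  exact: a_ge0.
rewrite -big_split/=; apply: ler_sum => j _.
have [js|sj] := ltnP j (size s); last first.
  rewrite nth_default ?size_map// add0r; apply: (singular_value_le (r := s)) => //.
  by move=> i; rewrite mem_sort; exact: re.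
have [i0 i0s] : exists i, i \in s by case: (s) js => // i l _; exists i; rewrite mem_head.
rewrite (nth_map i0)//.
apply: (singular_value_le (r := take j s)); rewrite ?addr_ge0//.
- exact: take_uniq.
- by rewrite size_take js.
move=> i ij; have [ir|/re ie] := boolP (i \in r); last by rewrite ler_wpDl.
rewrite ler_wpDr//.
have is_ : i \in s by rewrite mem_sort.
rewrite -(nth_index i0 is_); apply: (@sorted_leq_nth _ gea) => //.
- by move=> x y z xy yz; exact: le_trans yz xy.
- by move=> x; exact: lexx.
- by rewrite inE index_mem.
- by rewrite leqNgt; apply: contra ij => ij; rewrite in_take_leq // ltnW.
Qed.

(** The first [j.+1] members of the sorted list give that many orthonormal eigenvectors with
    eigenvalue at least its entry at position [j]. *)
Lemma sum_singular_value_ge (r : seq I) n : uniq r -> (size r <= n)%N ->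
  \sum_(i <- r) a i <= \sum_(j < n) singular_value T j.
Proof.
move=> ur rn; pose s := sort gea r.
have us : uniq s by rewrite sort_uniq.
have sorted_s : sorted gea s by apply: sort_sorted => i j; exact: le_total.
have -> : \sum_(i <- r) a i = \sum_(i <- s) a i.
  by apply: perm_big; rewrite perm_sym perm_sort.
rewrite -(size_sort gea) -/s in rn.
have [->|[i0 i0s]] : s = [::] \/ exists i, i \in s.
- by case: (s) => [|i l]; [left|right; exists i; rewrite mem_head].
- by rewrite big_nil sumr_ge0// => j _; exact: singular_value_ge0.
rewrite (big_nth i0) big_mkord (big_ord_widen n (fun j => a (nth i0 s j)))//.
rewrite big_mkcond/=; apply: ler_sum => j _; case: ifPn => js; last exact: singular_value_ge0.
apply: (singular_value_ge (s := take j.+1 s)) => //.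
- exact: take_uniq.
- by rewrite size_takel.
move=> i ij; have is_ : i \in s by exact: mem_take ij.
rewrite -[in leRHS](nth_index i0 is_); apply: (@sorted_leq_nth _ gea) => //.
- by move=> x y z xy yz; exact: le_trans yz xy.
- by move=> x; exact: lexx.
- by rewrite inE index_mem.
- by move: ij; rewrite in_take_leq.
Qed.

End DiagonalOperator.

(** * Abel summation *)

Section AbelSum.
Context (R : realType).

Lemma geometric_weighted_sum_le (d : nat -> R) (r C : R) n : 0 <= r -> r <= 1 ->
  (forall m, \sum_(q < m) d q <= C) -> \sum_(q < n) r ^+ q * d q <= C.
Proof.
move=> r0 r1; elim: n d C => [|n IH] d C dC.
  by have := dC 0%N; rewrite !big_ord0.
have d0C : 0 <= C - d 0%N by have := dC 1%N; rewrite big_ord1 subr_ge0.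
rewrite big_ord_recl expr0 mul1r.
under eq_bigr do rewrite lift0 exprS -mulrA.
rewrite -mulr_sumr.
have : \sum_(q < n) r ^+ q * d q.+1 <= C - d 0%N.
  apply: (IH (fun q => d q.+1)) => m.
  by rewrite lerBrDl; have := dC m.+1; rewrite big_ord_recl.
move=> /(ler_wpM2l r0) H; rewrite -lerBrDl; apply: (le_trans H).
by rewrite ler_piMl.
Qed.

Lemma geometric_weighted_sum_bound (b : nat -> R) (beta r C : R) n : 0 <= r -> r < 1 ->
  (forall m, `|\sum_(q < m) b q - beta *+ m| <= C) ->
  `|\sum_(q < n) r ^+ q * b q - beta * ((1 - r ^+ n) / (1 - r))| <= C.
Proof.
move=> r0 r1 bC.
have -> : beta * ((1 - r ^+ n) / (1 - r)) = \sum_(q < n) r ^+ q * beta.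
  rewrite -mulr_suml mulrC; congr (_ * _); apply: (mulIf (x := 1 - r)).
    by rewrite subr_eq0 gt_eqF.
  rewrite divfK ?subr_eq0 ?gt_eqF//.
  by apply: oppr_inj; rewrite opprB subrX1 -mulrN opprB mulrC.
rewrite -sumrB; under eq_bigr do rewrite -mulrBr.
have dE m : \sum_(q < m) (b q - beta) = \sum_(q < m) b q - beta *+ m.
  by rewrite sumrB sumr_const card_ord.
have {}bC m : `|\sum_(q < m) (b q - beta)| <= C by rewrite dE.
rewrite ler_norml; apply/andP; split.
  rewrite lerNl -sumrN; under eq_bigr do rewrite -mulrN.
  apply: (geometric_weighted_sum_le (d := fun q => - (b q - beta))) => //; first exact: ltW.
  by move=> m; rewrite sumrN; have := bC m; rewrite -normrN => /ler_normlW.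
apply: (geometric_weighted_sum_le (d := fun q => b q - beta)) => //; first exact: ltW.
by move=> m; have := bC m => /ler_normlW.
Qed.

(** Both bounds are 1 + y <= exp y, at y = -x and y = x. For x = (s - 1) ln rho they compare (s - 1)
    / (1 - rho^-(s-1)) with 1 / ln rho, up to an error s - 1. *)
Lemma one_minus_expR_bounds (x : R) : 0 < x ->
  1 <= x / (1 - expR (- x)) /\ x / (1 - expR (- x)) <= 1 + x.
Proof.
move=> x0; have e1 : 0 < 1 - expR (- x) by rewrite subr_gt0 expR_lt1 oppr_lt0.
split.
  by rewrite ler_pdivlMr// mul1r lerBlDl -lerBlDr (le_trans _ (expR_ge1Dx _))// addrC.
have : (1 + x) * expR (- x) <= 1.
  by rewrite expRN ler_pdivrMr ?expR_gt0// mul1r expR_ge1Dx.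
by rewrite ler_pdivrMr//; lra.
Qed.

End AbelSum.

(** * Logarithmic averages and Dixmier traces *)

Section LogAverages.
Context (R : realType).

Lemma ln_nat_gt (A : R) : \forall n \near \oo, A < ln n%:R.
Proof.
near=> n; have : expR A < n%:R by near: n; exact: nbhs_infty_gtr.
move=> An; have n0 : 0 < n%:R :> R by apply: lt_trans An; exact: expR_gt0.
by rewrite -(expRK A) ltr_ln ?posrE ?expR_gt0.
Unshelve. all: by end_near. Qed.

Lemma cvg_div_bounded (u L : nat -> R) (c K : R) :
  (\forall n \near \oo, `|u n - c * L n| <= K) ->
  (forall A, \forall n \near \oo, A < L n) ->
  (L n)^-1 * u n @[n --> \oo] --> c.
Proof.
move=> uK Loo; apply/cvgrPdist_lt => e e0.
near=> n.
have L0 : 0 < L n by near: n; exact: Loo.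
have Ke : K / e < L n by near: n; exact: Loo.
rewrite (_ : _ - _ = - ((u n - c * L n) / L n)); last by field; rewrite gt_eqF.
rewrite normrN normrM normfV (gtr0_norm L0) ltr_pdivrMr//.
apply: (@le_lt_trans _ _ K); first by near: n.
by rewrite mulrC -ltr_pdivrMr.
Unshelve. all: by end_near. Qed.

Lemma ln_succ_bound n : (0 < n)%N -> `|ln n.+1%:R - ln n%:R| <= ln 2 :> R.
Proof.
move=> n0; have n0' : 0 < n%:R :> R by rewrite ltr0n.
rewrite ger0_norm; last by rewrite subr_ge0 ler_ln ?posrE ?ltr0n// ler_nat.
rewrite lerBlDr -lnM ?posrE// ler_ln ?posrE ?mulr_gt0 ?ltr0n//.
by rewrite -natrM ler_nat mul2n -addnn -addn1 leq_add2l.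
Qed.

(** The sequence is a constant plus a null sequence. The uniform bound is there because [omega] is
    linear only on bounded sequences. *)
Lemma generalized_limit_cvg (omega : (nat -> R[i]) -> R[i]) (v : nat -> R) (c M : R) :
  generalized_limit omega -> (forall n, `|v n - c| <= M) -> v @ \oo --> c ->
  omega (fun n => (v n)%:C) = c%:C.
Proof.
move=> [lin _ om1 om0 _] vM vc.
have -> : (fun n => (v n)%:C) = (fun n => c%:C * 1 + (v n - c)%:C).
  by apply/funext => n; rewrite mulr1 rmorphB/= addrC subrK.
rewrite (lin c%:C (fun=> 1) (fun n => (v n - c)%:C)).
- rewrite om1 mulr1 om0 ?addr0//.
  rewrite (_ : (fun n => _) = fun n => `|v n - c|); last first.
    by apply/funext => n; rewrite normc_real.
  rewrite -[X in _ --> X](normr0 R) -[X in `|X|](subrr c).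
  by apply: cvg_norm; apply: cvgB => //; exact: cvg_cst.
- by exists 1 => n; rewrite normc1.
- by exists M => n; rewrite normc_real.
Qed.

Variables (sigma : nat -> R) (c K : R).
Hypothesis sigmaK : forall n, `|\sum_(j < n.+1) sigma j - c * ln n.+1%:R| <= K.

(** The Dixmier trace divides [n.+1] summands by ln(n + 2); changing the logarithm costs at most |c|
    ln 2. *)
Let log_sum2 n : `|\sum_(0 <= j < n.+1) sigma j - c * ln (2 + n)%:R| <= K + `|c| * ln 2.
Proof.
rewrite big_mkord (_ : _ - _ = (\sum_(j < n.+1) sigma j - c * ln n.+1%:R) -
  c * (ln n.+2%:R - ln n.+1%:R)); last by rewrite add2n mulrBr; ring.
apply: le_trans (ler_normB _ _) _; apply: lerD => //.
by rewrite normrM ler_wpM2l// ln_succ_bound.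
Qed.

Lemma log_average_cvg :
  (ln (2 + n)%:R)^-1 * \sum_(0 <= j < n.+1) sigma j @[n --> \oo] --> c.
Proof.
apply: (@cvg_div_bounded (fun n => \sum_(0 <= j < n.+1) sigma j)
    (fun n => ln (2 + n)%:R) _ (K + `|c| * ln 2)); first exact: nearW.
move=> A; have := ln_nat_gt A => -[N _ HN]; exists N => // n /= Nn.
by apply: HN; rewrite /= (leq_trans Nn)// leq_addl.
Qed.

Lemma log_average_bound n :
  `|(ln (2 + n)%:R)^-1 * \sum_(0 <= j < n.+1) sigma j - c| <= (K + `|c| * ln 2) / ln 2.
Proof.
have l2 : 0 < ln 2 :> R by rewrite ln_gt0// ltr1n.
have L2 : ln 2 <= ln (2 + n)%:R :> R by rewrite ler_ln ?posrE ?ltr0n// ler_nat leq_addr.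
have L0 := lt_le_trans l2 L2.
rewrite (_ : _ - _ =
  (\sum_(0 <= j < n.+1) sigma j - c * ln (2 + n)%:R) / ln (2 + n)%:R); last first.
  by field; rewrite gt_eqF.
rewrite normrM normfV (gtr0_norm L0).
apply: ler_pM => //; first by rewrite invr_ge0 ltW.
by rewrite lef_pV2 ?posrE.
Qed.

(** The form used by [dixmier_macaev], whose sum starts at 1: the missing [sigma 0] joins the
    bounded error. *)
Lemma log_average1_cvg :
  (ln n%:R)^-1 * \sum_(1 <= j < n.+1) sigma j @[n --> \oo] --> c.
Proof.
apply: (@cvg_div_bounded (fun n => \sum_(1 <= j < n.+1) sigma j)
    (fun n => ln n%:R) _ (K + `|c| * ln 2 + `|sigma 0|)); last exact: ln_nat_gt.
exists 1%N => // n /= n0.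
rewrite (_ : _ - _ = (\sum_(j < n.+1) sigma j - c * ln n.+1%:R) +
  c * (ln n.+1%:R - ln n%:R) - sigma 0); last first.
  rewrite -(big_mkord xpredT) (big_ltn (ltn0Sn n)). ring.
apply: le_trans (ler_normB _ _) _; apply: lerD => //.
apply: le_trans (ler_normD _ _) _; apply: lerD => //.
by rewrite normrM ler_wpM2l// ln_succ_bound.
Qed.

End LogAverages.

(** * Powers and Connes measurability of diagonal operators *)

Section GeometricDiagonal.
Context (R : realType) (I : choiceType) (a : I -> R).
Hypothesis a_ge0 : forall i, 0 <= a i.
Hypothesis a_bnd : exists M : R, forall i, a i <= M.
Local Notation T := (mul_op (fun i => (a i)%:C)).

Lemma op_pow_diag s : 0 < s -> op_pow T s = mul_op (fun i => (a i `^ s)%:C).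
Proof.
move=> s0; have [M aM] := a_bnd.
have ba : bounded_entries (fun i => (a i)%:C) by exact: diag_bounded_entries.
apply: spectral_funE.
- exists (M `^ s) => i; rewrite normc_real ger0_norm ?powR_ge0//.
  have M0 : 0 <= M by exact: le_trans (aM i).
  by apply: ge0_ler_powR; rewrite ?nnegrE ?(ltW s0).
- move=> mu u i Tu ui; congr (_ `^ s).
  have : T u i = mu%:C * u i by rewrite Tu ell2Z.
  by rewrite mul_opE// => /(mulIf ui) [].
- move=> i; exists [:: (a i, basis_vec R i)]; split; last by rewrite big_seq1.
  by move=> p; rewrite inE => /eqP -> /=; rewrite mul_op_basis.
Qed.

Lemma op_trace_pow_diag s : 0 < s ->
  op_trace (op_pow T s) = \esum_(i in [set: I]) (a i `^ s)%:E.
Proof.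
move=> s0; rewrite op_pow_diag// diag_trace//; have [M aM] := a_bnd.
- by move=> i; exact: powR_ge0.
- exists (M `^ s) => i; have M0 : 0 <= M by exact: le_trans (aM i).
  by apply: ge0_ler_powR; rewrite ?nnegrE ?(ltW s0).
Qed.

Lemma connes_measurable_log (c K : R) :
  (forall e : R, 0 < e -> exists r : seq I, forall i, i \notin r -> a i <= e) ->
  (forall n, `|\sum_(j < n.+1) singular_value T j - c * ln n.+1%:R| <= K) ->
  connes_measurable T c%:C.
Proof.
move=> a0 svK; split; first exact: diag_positive.
  split.
    apply: mul_op_compact; last exact: diag_bounded_entries.
    move=> e /a0[r ra]; exists r => i /ra.
    by rewrite normc_real ger0_norm.
  set u := fun n => _.
  have : u @ \oo --> c%:E.
    apply: cvg_EFin; first exact: nearW.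
    exact: log_average1_cvg svK.
  by move=> /cvg_limn_einf_sup[_ ->]; rewrite ltry.
move=> omega om; apply: (generalized_limit_cvg om (log_average_bound svK)).
exact: log_average_cvg svK.
Qed.

End GeometricDiagonal.

(** * Eigenvalues in geometric blocks *)

Section GeometricBlocks.
Context (R : realType) (I : choiceType) (a : I -> R) (blk : nat -> seq I) (lev : I -> nat).
Context (rho c1 c2 d1 d2 beta C : R).
Hypothesis uniq_blk : forall q, uniq (blk q).
Hypothesis mem_blk : forall q i, (i \in blk q) = (lev i == q).
Hypothesis rho_gt1 : 1 < rho.
Hypothesis c1_gt0 : 0 < c1.
Hypothesis c2_gt0 : 0 < c2.
Hypothesis d1_gt0 : 0 < d1.
Hypothesis a_ge0 : forall i, 0 <= a i.
Hypothesis a_ge : forall i, a i != 0 -> c1 / rho ^+ lev i <= a i.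
Hypothesis a_le : forall i, a i <= c2 / rho ^+ lev i.
Hypothesis size_ge : forall q, d1 * rho ^+ q <= (size (blk q))%:R.
Hypothesis size_le : forall q, (size (blk q))%:R <= d2 * rho ^+ q.
Hypothesis beta_ge0 : 0 <= beta.
Let b q := \sum_(i <- blk q) a i.
Hypothesis sum_b : forall n, `|\sum_(q < n) b q - beta *+ n| <= C.

Local Notation T := (mul_op (fun i => (a i)%:C)).
Let rho_gt0 : 0 < rho := lt_trans ltr01 rho_gt1.

Let N q := (\sum_(p < q) size (blk p))%N.
Let F q := flatten [seq blk p | p <- iota 0 q].

Let F_S q : F q.+1 = F q ++ blk q.
Proof. by rewrite /F -addn1 iotaD map_cat flatten_cat /= cats0. Qed.

Let mem_F q i : (i \in F q) = (lev i < q)%N.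
Proof.
elim: q => [|q IH]; first by rewrite ltn0.
by rewrite F_S mem_cat IH mem_blk ltnS [RHS]leq_eqVlt orbC.
Qed.

Let uniq_F q : uniq (F q).
Proof.
elim: q => // q IH; rewrite F_S cat_uniq IH uniq_blk andbT /=.
by apply/hasPn => i; rewrite mem_blk mem_F => /eqP ->; rewrite ltnn.
Qed.

Let size_F q : size (F q) = N q.
Proof. by elim: q => [|q IH]; rewrite /N ?big_ord0// F_S size_cat IH /N big_ord_recr. Qed.

Let sum_F (f : I -> R) q : \sum_(i <- F q) f i = \sum_(p < q) \sum_(i <- blk p) f i.
Proof.
elim: q => [|q IH]; first by rewrite big_ord0 big_nil.
by rewrite F_S big_cat IH big_ord_recr.
Qed.

Let a_bnd : exists M : R, forall i, a i <= M.
Proof.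
exists c2 => i; apply: le_trans (a_le i) _.
by rewrite ler_pdivrMr ?exprn_gt0// ler_peMr ?(ltW c2_gt0)// exprn_ege1// ltW.
Qed.

(** From the geometric series d2 (1 + rho + ... + rho^(q-1)) that bounds [N q]. *)
Let D := d2 / (rho - 1).

Let N_le q : (N q)%:R <= D * rho ^+ q.
Proof.
rewrite /N natr_sum.
apply: (@le_trans _ _ (\sum_(p < q) d2 * rho ^+ p)); first by apply: ler_sum.
rewrite -mulr_sumr /D -mulrA ler_wpM2l//.
  have := le_trans (ltW _) (size_le 0); rewrite expr0 mulr1; apply.
  by apply: lt_le_trans (size_ge 0); rewrite expr0 mulr1.
rewrite ler_pdivlMl ?subr_gt0// -subrX1 lerBlDr lerDl ler01//.
Qed.

Let N_ge q : d1 * rho ^+ q <= (N q.+1)%:R.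
Proof.
by rewrite /N big_ord_recr natrD ler_wpDl.
Qed.

Let N_bracket n : exists q, (N q <= n < N q.+1)%N.
Proof.
have N_lt q : (N q < N q.+1)%N.
  rewrite [N q.+1]/N big_ord_recr /= -/(N q) -[X in (X < _)%N]addn0 ltn_add2l -(ltr_nat R).
  by apply: lt_le_trans (size_ge q); rewrite mulr_gt0 ?exprn_gt0.
elim: n => [|n [q /andP[Nq nN]]]; first exists 0%N.
  by rewrite (leq_trans _ (N_lt 0%N)) {1}/N big_ord0.
have [H|H] := ltnP n.+1 (N q.+1); first by exists q; rewrite H (leq_trans Nq).
by exists q.+1; rewrite H (leq_ltn_trans _ (N_lt q.+1)).
Qed.

(** Take q with N q <= n + 1 < N (q + 1). The sum of the first n + 1 singular values is at least
    that of [a] over [F q], and exceeds it by a bounded amount, since entries outside [F q] are at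
    most c2 / rho^q while n + 1 is at most of order rho^q. It remains to compare q with ln(n + 1) /
    ln rho. *)
Lemma sum_singular_value_log : exists K : R, forall n,
  `|\sum_(j < n.+1) singular_value T j - beta / ln rho * ln n.+1%:R| <= K.
Proof.
have lrho : 0 < ln rho by rewrite ln_gt0.
(* The minimum with 1 is for q = 0, where only n + 1 >= 1 is known and [d' / rho <= 1] is needed. *)
pose d' := Num.min d1 1.
have d'0 : 0 < d' by rewrite lt_min d1_gt0 ltr01.
pose E1 := ln (D * rho).
pose E2 := - ln (d' / rho).
(* The cutoff c2 / rho^q times the bound D rho^(q+1) for n + 1. *)
pose K1 := c2 * (D * rho).
exists (C + `|K1| + beta / ln rho * (`|E1| + `|E2|)) => n.
have [q /andP[Nq nN]] := N_bracket n.+1.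
have DR : 0 < D * rho.
  have := lt_le_trans (mulr_gt0 d1_gt0 (exprn_gt0 0 rho_gt0)) (le_trans (N_ge 0) (N_le 1)).
  by rewrite expr1.
have S_ge : \sum_(p < q) b p <= \sum_(j < n.+1) singular_value T j.
  rewrite -sum_F; apply: sum_singular_value_ge => //.
  by rewrite size_F.
have S_le : \sum_(j < n.+1) singular_value T j <= \sum_(p < q) b p + K1.
  rewrite -sum_F.
  apply: le_trans (sum_singular_value_le (e := c2 / rho ^+ q) _ _ _ _ (uniq_F q) _) _ => //.
  - by rewrite divr_ge0 ?exprn_ge0 ?ltW.
  - move=> i; rewrite mem_F -leqNgt => qi; apply: le_trans (a_le i) _.
    rewrite ler_pM2l// lef_pV2 ?posrE ?exprn_gt0//.
    by rewrite ler_weXn2l// ltW.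
  rewrite lerD2l -mulr_natr -mulrA ler_pM2l// mulrC ler_pdivrMr ?exprn_gt0//.
  rewrite -mulrA -exprS; apply: le_trans (N_le q.+1).
  by rewrite ler_nat ltnW.
have L_le : ln n.+1%:R <= E1 + ln rho *+ q.
  rewrite -lnXn// -lnM ?posrE ?exprn_gt0//.
  rewrite ler_ln ?posrE ?(mulr_gt0 DR (exprn_gt0 q rho_gt0))//.
  rewrite -mulrA -exprS; apply: le_trans (N_le q.+1).
  by rewrite ler_nat ltnW.
have L_ge : ln rho *+ q - E2 <= ln n.+1%:R.
  rewrite /E2 opprK -lnXn// -lnM ?posrE ?exprn_gt0 ?divr_gt0//.
  rewrite ler_ln ?posrE ?mulr_gt0 ?exprn_gt0 ?divr_gt0 ?invr_gt0//.
  case: q Nq nN {S_ge S_le L_le} => [|q] Nq nN.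
    rewrite expr0 mul1r (le_trans (y := 1)) ?ler1n//.
    by rewrite ler_pdivrMr// mul1r (le_trans (y := 1)) ?(ltW rho_gt1)// ge_min lexx orbT.
  rewrite exprSr -mulrA [rho * (_ / _)]mulrC divfK ?gt_eqF// mulrC.
  apply: le_trans (_ : (N q.+1)%:R <= _); last by rewrite ler_nat.
  apply: le_trans (N_ge q); rewrite ler_pM2r ?exprn_gt0//.
  by rewrite ge_min lexx.
have L_q : `|ln n.+1%:R - ln rho *+ q| <= `|E1| + `|E2|.
  have e1 := ler_norm E1; have e2 := ler_norm E2.
  have e3 := normr_ge0 E1; have e4 := normr_ge0 E2.
  move: L_le L_ge; set x := ln rho *+ q; set y := ln _ => L_le L_ge.
  rewrite ler_norml; apply/andP; split; lra.
have S_q : `|\sum_(j < n.+1) singular_value T j - \sum_(p < q) b p| <= `|K1|.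
  by rewrite [leLHS]ger0_norm ?subr_ge0// lerBlDl (le_trans S_le)// lerD2l ler_norm.
rewrite (_ : _ - _ = (\sum_(j < n.+1) singular_value T j - \sum_(p < q) b p) +
    (\sum_(p < q) b p - beta *+ q) - beta / ln rho * (ln n.+1%:R - ln rho *+ q)); last first.
  rewrite -mulr_natr -[ln rho *+ q]mulr_natr; field.
  by rewrite gt_eqF.
apply: le_trans (ler_normB _ _) _; apply: lerD.
  by apply: le_trans (ler_normD _ _) _; rewrite addrC lerD.
by rewrite normrM ger0_norm ?divr_ge0 ?(ltW lrho)// ler_wpM2l ?divr_ge0 ?(ltW lrho).
Qed.

Local Notation Z s := (\esum_(i in [set: I]) (a i `^ s)%:E).

(** Write a^s = a^(s-1) a. On block [q] a nonzero entry lies between c1 / rho^q and c2 / rho^q, so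
    the first factor is [r ^+ q] up to constants to the power s - 1, which tend to 1 as s decreases
    to 1. *)
Let blk_pow s q : 1 < s -> let r := rho `^ (- (s - 1)) in
  c1 `^ (s - 1) * (r ^+ q * b q) <= \sum_(i <- blk q) a i `^ s /\
  \sum_(i <- blk q) a i `^ s <= c2 `^ (s - 1) * (r ^+ q * b q).
Proof.
move=> s1 r; rewrite /b !mulrA !mulr_sumr.
have rE (c : R) : 0 < c -> (c / rho ^+ q) `^ (s - 1) = c `^ (s - 1) * r ^+ q.
  move=> c0; rewrite powRM ?invr_ge0 ?exprn_ge0 ?(ltW rho_gt0) ?(ltW c0)//.
  have -> : r ^+ q = rho `^ (- (q%:R * (s - 1))).
    by rewrite /r -powR_mulrn ?powR_ge0// -powRrM mulNr mulrC.
  by rewrite -(powR_mulrn q (ltW rho_gt0)) -powRN -powRrM mulNr.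
have sE i : a i `^ s = a i `^ (s - 1) * a i.
  by rewrite mulrC mulr_powRB1// (lt_trans _ s1).
have s0 : 0 <= s - 1 by rewrite subr_ge0 ltW.
have sn0 : s != 0 by rewrite gt_eqF// (lt_trans _ s1).
split; rewrite !big_seq; apply: ler_sum => i; rewrite mem_blk => /eqP iq.
  have [->|ai] := eqVneq (a i) 0; first by rewrite mulr0 powR0.
  rewrite sE// ler_wpM2r// -rE// ge0_ler_powR ?nnegrE//
    ?divr_ge0 ?exprn_ge0 ?(ltW rho_gt0) ?(ltW c1_gt0)//.
  by rewrite -iq a_ge.
have [->|ai] := eqVneq (a i) 0; first by rewrite mulr0 powR0.
rewrite sE// ler_wpM2r// -rE// ge0_ler_powR ?nnegrE//
  ?divr_ge0 ?exprn_ge0 ?(ltW rho_gt0) ?(ltW c2_gt0)//.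
by rewrite -iq a_le.
Qed.

Let blk_pow_sum s n : 1 < s -> let r := rho `^ (- (s - 1)) in
  c1 `^ (s - 1) * (beta * ((1 - r ^+ n) / (1 - r)) - C) <= \sum_(i <- F n) a i `^ s /\
  \sum_(i <- F n) a i `^ s <= c2 `^ (s - 1) * (beta / (1 - r) + C).
Proof.
move=> s1 r; have r0 : 0 < r by rewrite powR_gt0.
have r1 : r < 1.
  rewrite /r /powR gt_eqF// expR_lt1 mulNr oppr_lt0 mulr_gt0 ?subr_gt0//.
  by rewrite ln_gt0.
have /ler_normlP[H1 H2] := geometric_weighted_sum_bound n (ltW r0) r1 sum_b.
rewrite sum_F; split.
  apply: (@le_trans _ _ (\sum_(q < n) c1 `^ (s - 1) * (r ^+ q * b q))); last first.
    by apply: ler_sum => q _; case: (blk_pow q s1).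
  rewrite -mulr_sumr ler_wpM2l ?powR_ge0//.
  by move: H1; rewrite opprB; lra.
apply: (@le_trans _ _ (\sum_(q < n) c2 `^ (s - 1) * (r ^+ q * b q))).
  by apply: ler_sum => q _; case: (blk_pow q s1).
rewrite -mulr_sumr ler_wpM2l ?powR_ge0//.
rewrite -lerBlDl; apply: le_trans H2; rewrite lerB// ler_wpM2l//.
rewrite ler_pdivrMr ?divr_gt0 ?subr_gt0// mulVf ?subr_eq0 ?gt_eqF//.
by rewrite gerBl exprn_ge0// ltW.
Qed.

(** Multiplied by t, the geometric factor 1 / (1 - r) lies between 1 / ln rho and 1 / ln rho + t, so
    both outer bounds tend to beta / ln rho with t. Finiteness is recorded because [fine] would hide
    an infinite sum. *)
Lemma esum_pow_bounds s : 1 < s -> let t := s - 1 in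
  c1 `^ t * (beta / ln rho - C * t) <= t * fine (Z s) /\
  t * fine (Z s) <= c2 `^ t * (beta / ln rho + (beta + C) * t) /\ (Z s \is a fin_num).
Proof.
move=> s1 t; have t0 : 0 < t by rewrite subr_gt0.
have lrho : 0 < ln rho by rewrite ln_gt0.
pose r := rho `^ (- t).
have rE : r = expR (- (t * ln rho)) by rewrite /r /powR gt_eqF// mulNr.
have r0 : 0 < r by rewrite rE expR_gt0.
have r1 : r < 1 by rewrite rE expR_lt1 oppr_lt0 mulr_gt0.
have [] := one_minus_expR_bounds (mulr_gt0 t0 lrho); rewrite -rE => L1 L2.
have trE : t / (1 - r) = t * ln rho / (1 - r) / ln rho.
  by field; rewrite subr_eq0 !gt_eqF.
have Z_le : (Z s <= (c2 `^ t * (beta / (1 - r) + C))%:E)%E.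
  apply: esum_le_seq => l ul; rewrite lee_fin.
  have [n ln] : exists n, {subset l <= F n}.
    exists (\max_(i <- l) (lev i).+1)%N => i il; rewrite mem_F.
    exact: (@leq_bigmax_seq _ _ xpredT (fun i => (lev i).+1)).
  apply: (@le_trans _ _ (\sum_(i <- F n) a i `^ s)); last by case: (blk_pow_sum n s1).
  by apply: sumr_uniq_sub => // i; exact: powR_ge0.
have Zfin : Z s \is a fin_num.
  by rewrite ge0_fin_numE ?(le_lt_trans Z_le) ?ltry//;
    apply: esum_ge0 => i _; rewrite lee_fin powR_ge0.
have Z_ge : c1 `^ t * (beta / (1 - r) - C) <= fine (Z s).
  apply: (cvgr_to_le (F := \oo) (f := fun n => c1 `^ t * (beta * ((1 - r ^+ n) / (1 - r)) - C))).
    apply: cvgM; first exact: cvg_cst.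
    apply: cvgB; last exact: cvg_cst.
    apply: cvgM; first exact: cvg_cst.
    rewrite -[X in _ --> X]mul1r; apply: cvgM; last exact: cvg_cst.
    rewrite -[X in _ --> X]subr0; apply: cvgB; first exact: cvg_cst.
    by apply: cvg_expr; rewrite ger0_norm// ltW.
  apply: nearW => n; have [H _] := blk_pow_sum n s1; apply: (le_trans H).
  rewrite -lee_fin fineK//; apply: esum_ge_seq => // i; exact: powR_ge0.
have key1 : beta / ln rho <= t * (beta / (1 - r)).
  by rewrite mulrCA trE ler_wpM2l// -[leLHS]mul1r ler_wpM2r// invr_ge0 ltW.
have key2 : t * (beta / (1 - r)) <= beta / ln rho + beta * t.
  rewrite mulrCA trE -mulrDr ler_wpM2l// ler_pdivrMr// (le_trans L2)//.
  by rewrite [leRHS]mulrDl mulVf ?gt_eqF.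
split; [|split=> //].
  rewrite -ler_pdivrMl//; apply: le_trans Z_ge; rewrite mulrCA ler_wpM2l ?powR_ge0//.
  by rewrite ler_pdivrMl// [leRHS]mulrBr [C * t]mulrC lerB.
have {}Z_le : fine (Z s) <= c2 `^ t * (beta / (1 - r) + C) by rewrite -lee_fin fineK.
rewrite -ler_pdivlMl//; apply: (le_trans Z_le).
rewrite mulrCA ler_wpM2l ?powR_ge0// ler_pdivlMl// [leLHS]mulrDr [(beta + C) * t]mulrDl addrA.
by rewrite [t * C]mulrC lerD.
Qed.

Lemma powR_sub1_cvg (c : R) : 0 < c -> (c `^ (s - 1)) @[s --> 1^'+] --> (1 : R).
Proof.
move=> c0; rewrite (_ : (fun s => _) = fun s => expR ((s - 1) * ln c)); last first.
  by apply/funext => s; rewrite /powR gt_eqF.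
have H : (fun s => expR ((s - 1) * ln c)) @ (1 : R) --> expR ((1 - 1) * ln c).
  apply: continuous_cvg; first exact: continuous_expR.
  by apply: cvgM; [apply: cvgB; [exact: cvg_id|exact: cvg_cst]|exact: cvg_cst].
by rewrite subrr mul0r expR0 in H; exact: cvg_at_right_filter.
Qed.

Lemma esum_pow_cvg : ((s - 1)%:E * Z s)%E @[s --> 1^'+] --> (beta / ln rho)%:E.
Proof.
have Zb s : 1 < s -> _ := @esum_pow_bounds s.
apply: cvg_EFin.
  near=> s; have [|_ [_ Zf]] := Zb s; first by near: s; exact: nbhs_right_gt.
  by rewrite fin_numM.
have lin (d : R) : ((beta / ln rho + d * (s - 1))) @[s --> 1^'+] --> beta / ln rho.
  rewrite -[X in _ --> X]addr0 -[X in _ + X](mulr0 d) -[X in d * X](subrr 1).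
  apply: cvg_at_right_filter; apply: cvgD; first exact: cvg_cst.
  by apply: cvgM; [exact: cvg_cst|apply: cvgB; [exact: cvg_id|exact: cvg_cst]].
apply: (@squeeze_cvgr _ _ _ _ (fun s => c1 `^ (s - 1) * (beta / ln rho + (- C) * (s - 1)))
   (fun s => c2 `^ (s - 1) * (beta / ln rho + (beta + C) * (s - 1)))).
- near=> s; have [|H1 [H2 Zf]] := Zb s; first by near: s; exact: nbhs_right_gt.
  by rewrite /= fineM// mulNr H1 H2.
- by rewrite -[X in _ --> X]mul1r; apply: cvgM; [exact: powR_sub1_cvg|exact: lin].
- by rewrite -[X in _ --> X]mul1r; apply: cvgM; [exact: powR_sub1_cvg|exact: lin].
Unshelve. all: by end_near. Qed.

Lemma geometric_blocks_vanish (e : R) : 0 < e ->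
  exists r : seq I, forall i, i \notin r -> a i <= e.
Proof.
move=> e0; have ec : 0 < e / c2 by rewrite divr_gt0.
have ri : `|rho^-1| < 1 by rewrite normfV (gtr0_norm rho_gt0) invf_lt1.
have /cvgrPdist_lt/(_ _ ec)[q _ /(_ q (leqnn q))] := cvg_expr ri.
rewrite /= sub0r normrN exprVn normfV gtr0_norm ?exprn_gt0// => H.
exists (F q) => i; rewrite mem_F -leqNgt => qi; apply: le_trans (a_le i) _.
apply: (@le_trans _ _ (c2 / rho ^+ q)).
  by rewrite ler_pM2l// lef_pV2 ?posrE ?exprn_gt0// ler_weXn2l// ltW.
by rewrite mulrC -ler_pdivlMr// ltW.
Qed.

Lemma geometric_blocks_dixmier :
  connes_measurable T (beta / ln rho)%:C /\
  ((s - 1)%:E * op_trace (op_pow T s))%E @[s --> 1^'+] --> (beta / ln rho)%:E.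
Proof.
split.
  have [D0 svD] := sum_singular_value_log.
  by apply: connes_measurable_log svD => // e; exact: geometric_blocks_vanish.
apply: cvg_trans esum_pow_cvg; apply: near_eq_cvg.
near=> s; rewrite op_trace_pow_diag//.
by apply: (@lt_trans _ _ 1) => //; near: s; exact: nbhs_right_gt.
Unshelve. all: by end_near. Qed.

End GeometricBlocks.

(** * The mean ergodic theorem for nonnegative matrices *)

Section MeanErgodic.
Context (R : realType).

Lemma bounded_mulrn_eq0 (x M : R) : (forall m, `|x *+ m| <= M) -> x = 0.
Proof.
move=> xM; apply/eqP; rewrite -normr_eq0; apply/negPn/negP => x0.
have {}x0 : 0 < `|x| by rewrite lt_neqAle eq_sym x0 normr_ge0.
have := archi_boundP (normr_ge0 (M / `|x|)); set m := Num.Def.archi_bound _.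
rewrite ltNge => /negP; apply; apply: (le_trans _ (ler_norm _)).
by rewrite ler_pdivlMr// mulr_natl -normrMn.
Qed.

Section RowVectors.
Context (n : nat) (A : 'M[R]_n).
Let P (u : 'rV[R]_n) k := iter k (mulmxr A) u.
Hypothesis power_bounded : forall u, exists M, forall k j, `|P u k 0 j| <= M.

Let P_D u v k : P (u + v) k = P u k + P v k.
Proof. by elim: k => // k IH; rewrite /P /= -!/(P _ _) IH mulmxDl. Qed.

Let P_sub y k : P (y *m (A - 1%:M)) k = P y k.+1 - P y k.
Proof.
elim: k => [|k IH]; first by rewrite /P/= mulmxBr mulmx1.
by rewrite {1}/P /= -/(P _ _) IH mulmxBl.
Qed.

Let sum_P_sub y m : \sum_(k < m) P (y *m (A - 1%:M)) k = P y m - y.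
Proof.
under eq_bigr do rewrite P_sub.
by rewrite -(big_mkord xpredT (fun k => P y k.+1 - P y k)) telescope_sumr.
Qed.

Let P_fix v k : v *m (A - 1%:M) = 0 -> P v k = v.
Proof.
rewrite mulmxBr mulmx1 => /eqP; rewrite subr_eq0 => /eqP vA.
by elim: k => // k IH; rewrite /P /= -/(P _ _) IH.
Qed.

(** If v = y (A - 1) is fixed by A, telescoping gives m v = [P y m - y], which stays bounded in m;
    so v = 0. *)
Let ker_im_cap : (kermx (A - 1%:M) :&: (A - 1%:M))%MS = 0.
Proof.
apply/eqP; rewrite -submx0; apply/row_subP => i.
set v := row i _.
have : (v <= kermx (A - 1%:M) :&: (A - 1%:M))%MS by exact: row_sub.
rewrite sub_capmx => /andP[/sub_kermxP v0 /submxP[y vy]].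
suff -> : v = 0 by rewrite sub0mx.
apply/rowP => j; rewrite [RHS]mxE; have [M yM] := power_bounded y.
apply: (@bounded_mulrn_eq0 _ (M + M)) => m.
have -> : v 0 j *+ m = (P y m - y) 0 j.
  rewrite -sum_P_sub -vy; under eq_bigr do rewrite P_fix//.
  by rewrite sumr_const card_ord mulmxnE.
rewrite !mxE; apply: le_trans (ler_normB _ _) _; apply: lerD => //.
exact: (yM 0%N).
Qed.

(** By rank-nullity, the trivial intersection makes kernel plus image of A - 1 the whole space. The
    kernel part of [u] is the witness [w]. *)
Lemma mean_ergodic_row u : exists (w : 'rV[R]_n) (C : R), forall m j,
  `|\sum_(k < m) P u k 0 j - w 0 j *+ m| <= C.
Proof.
have : (u <= kermx (A - 1%:M) + (A - 1%:M))%MS.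
  apply: submx_full; rewrite /row_full; apply/eqP.
  have := mxrank_sum_cap (kermx (A - 1%:M)) (A - 1%:M).
  rewrite ker_im_cap mxrank0 addn0 mxrank_ker => ->.
  by rewrite subnK// rank_leq_row.
move=> /sub_addsmxP[[w y] /= ->]; set v := w *m kermx _.
have v0 : v *m (A - 1%:M) = 0 by rewrite /v -mulmxA mulmx_ker mulmx0.
clearbody v.
have [M yM] := power_bounded y.
exists v, (M + M) => m j.
rewrite -summxE; under eq_bigr do rewrite P_D P_fix//.
rewrite big_split/= sum_P_sub sumr_const card_ord !mxE mulmxnE.
rewrite addrAC subrr add0r.
by apply: le_trans (ler_normB _ _) _; apply: lerD => //; exact: (yM 0%N).
Qed.

End RowVectors.

Context (V : eqType) (s : seq V) (B : V -> V -> R) (x : V -> R).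
Hypothesis us : uniq s.
Hypothesis sT : forall v, v \in s.
Hypothesis B_ge0 : forall p q, 0 <= B p q.
Hypothesis x_gt0 : forall p, 0 < x p.
Hypothesis Bx : forall p, \sum_(q <- s) B p q * x q = x p.
Let U (f : V -> R) p := \sum_(q <- s) B p q * f q.

(** Domination by [M * x] is preserved because [B] is nonnegative and U x = x. *)
Let U_bounded (f : V -> R) M k p : (forall q, `|f q| <= M * x q) ->
  `|iter k U f p| <= M * x p.
Proof.
move=> fM; elim: k p => [//|k IH] p /=.
apply: le_trans (ler_norm_sum _ _ _) _.
rewrite -Bx mulr_sumr; apply: ler_sum => q _.
by rewrite normrM (ger0_norm (B_ge0 _ _)) mulrCA ler_wpM2l.
Qed.

(* The averages converge because, by power boundedness, R^s is the direct sum of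
   the kernel and the image of [U - 1]; the error telescopes on the image. *)
Lemma mean_ergodic (f : V -> R) : exists w C, forall m p,
  `|\sum_(k < m) iter k U f p - w p *+ m| <= C.
Proof.
pose e := tnth (in_tuple s).
have eK p : {j | e j = p}.
  by apply: cid; have /tnthP[j ->] : p \in in_tuple s := sT p; exists j.
pose g p := sval (eK p).
have gK p : e (g p) = p by exact: svalP (eK p).
(* The transpose of [B], because row vectors are multiplied on the right. *)
pose A := \matrix_(i, j) B (e j) (e i).
pose r (h : V -> R) := \row_j h (e j).
have rU h : r (U h) = r h *m A.
  apply/rowP => j; rewrite !mxE /U big_tnth; apply: eq_bigr => i _.
  by rewrite !mxE mulrC.
have rUk k h : iter k (mulmxr A) (r h) = r (iter k U h).
  by elim: k => // k IH; rewrite !iterS IH rU.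
have pb (u : 'rV[R]_(size s)) : exists M, forall k j, `|iter k (mulmxr A) u 0 j| <= M.
  pose h p := u 0 (g p).
  have ge : injective e by apply/tuple_uniqP.
  have -> : u = r h.
    by apply/rowP => j; rewrite mxE /h; congr (u 0 _); apply: ge; rewrite gK.
  (* Since [x] is positive, [M * x] dominates |h|; [X] bounds the entries of [x]. *)
  pose M := \sum_(q <- s) `|h q| / x q; pose X := \sum_(q <- s) x q.
  have le1 (F : V -> R) q : (forall q, 0 <= F q) -> F q <= \sum_(q <- s) F q.
    by move=> F0; rewrite (bigD1_seq q)//= lerDl sumr_ge0.
  exists (M * X) => k j; rewrite rUk mxE.
  apply: (@le_trans _ _ (M * x (e j))).
    apply: U_bounded => q; rewrite -ler_pdivrMr//.
    by apply: (le1 (fun q => `|h q| / x q)) => q'; rewrite divr_ge0// ltW.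
  rewrite ler_wpM2l ?sumr_ge0// => [q _|]; first by rewrite divr_ge0// ltW.
  by apply: le1 => q; exact: ltW.
have [w [C wC]] := mean_ergodic_row pb (r f).
exists (fun p => w 0 (g p)), C => m p.
have := wC m (g p); under eq_bigr do rewrite rUk mxE gK.
by [].
Qed.

End MeanErgodic.

(** * Paths of the Bratteli diagram *)

Section Paths.
Context (R : realType) (k : nat) (L : kgraph k.+1) (finL : finite_kgraph L).
Local Notation V := (kobj L).
Local Notation K := k.+1.

Lemma kobj_finite : finite_set [set: V].
Proof.
rewrite (_ : [set: V] = (@ksrc _ L) @` [set l | kdeg l = 0]).
  exact/finite_image/finL.
apply/seteqP; split=> // v _; exists (kid v); first exact: kdeg_id.
exact: ksrc_id.
Qed.

Definition kvertices : seq V := fset_set [set: V].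

Lemma uniq_kvertices : uniq kvertices.
Proof. exact: fset_uniq. Qed.

Lemma mem_kvertices v : v \in kvertices.
Proof. by rewrite in_fset_set ?inE//; exact: kobj_finite. Qed.

Lemma fsum_kvertices (f : V -> R) :
  \sum_(v \in [set: V]) f v = \sum_(v <- kvertices) f v.
Proof. by rewrite fsbig_finite//; exact: kobj_finite. Qed.

Definition out_edges n (v : V) : seq (bedge L) :=
  [seq (existT _ (n, (v, q)) j : bedge L) | q <- kvertices, j <- enum 'I_(adj (inZp n) v q)].

Lemma mem_out_edges n v e : (e \in out_edges n v) = (blevel e == n) && (brng e == v).
Proof.
apply/idP/andP => [/allpairsPdep[q [j [_ _ ->]]]|]; first by rewrite !eqxx.
case: e => -[n' [v' q]] j [/eqP/= n'n /eqP/= v'v].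
rewrite /blevel /brng /= in n'n v'v; subst n' v'.
by apply/allpairsPdep; exists q, j; rewrite mem_kvertices mem_enum.
Qed.

Lemma uniq_out_edges n v : uniq (out_edges n v).
Proof.
apply: allpairs_uniq_dep => [|q _|]; first exact: uniq_kvertices.
  exact: enum_uniq.
move=> [q j] [q' j'] _ _ /= E.
have qq : q = q' by exact: (congr1 (fun e : bedge L => bsrc e) E).
subst q'; congr (Tagged _ _).
exact: eq_from_Tagged E.
Qed.

Definition path_src (p : V * seq (bedge L)) : V := last p.1 (map (@bsrc _ L) p.2).

Fixpoint raw_paths n : seq (V * seq (bedge L)) :=
  if n is n'.+1 then
    [seq (p.1, rcons p.2 e) | p <- raw_paths n', e <- out_edges n' (path_src p)]
  else [seq (v, [::]) | v <- kvertices].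

Lemma valid_from_rcons n (v : V) s (e : bedge L) : valid_from n v (rcons s e) =
  [&& valid_from n v s, blevel e == (n + size s)%N & brng e == path_src (v, s)].
Proof.
elim: s n v => [|e' s IH] n v /=; first by rewrite addn0 andbT.
by rewrite IH addSnnS -!andbA.
Qed.

Lemma mem_raw_paths n p :
  (p \in raw_paths n) = valid_from 0 p.1 p.2 && (size p.2 == n).
Proof.
case: p => v s /=; elim: n v s => [|n IH] v s.
  apply/mapP/andP => [[w _ [_ ->]]//|[_ /nilP ->]].
  by exists v => //; exact: mem_kvertices.
apply/allpairsPdep/andP => [[[v' s'] [e [ps es /= [-> ->]]]]|].
  move: ps; rewrite IH => /andP[vs /eqP sn].
  by rewrite valid_from_rcons vs size_rcons sn add0n eqxx -mem_out_edges es.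
case/lastP: s => [[]//|s e]; rewrite valid_from_rcons size_rcons eqSS => -[/and3P[vs le re] sn].
exists (v, s), e; rewrite IH vs sn mem_out_edges re andbT; split=> //.
by rewrite andbT (eqP le) (eqP sn).
Qed.

Lemma uniq_raw_paths n : uniq (raw_paths n).
Proof.
elim: n => [|n IH] /=; first by rewrite map_inj_uniq ?uniq_kvertices// => v w [].
apply: allpairs_uniq_dep => // [p _|]; first exact: uniq_out_edges.
move=> [[v s] e] [[v' s'] e'] _ _ /= [vv /rcons_inj[ss ee]].
by subst.
Qed.

Definition adj_op n (f : V -> R) (v : V) : R :=
  \sum_(q <- kvertices) (adj (inZp n : 'I_K) v q)%:R * f q.

(** A path has as many one-edge extensions with source [q] as the adjacency entry from its own
    source to [q], and [chi] does not see the added edge. Summing over extensions thus applies the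
    adjacency matrix at the source. *)
Lemma sum_raw_pathsS n (chi : V * seq (bedge L) -> R) (f : V -> R) :
  (forall p e, p \in raw_paths n -> chi (p.1, rcons p.2 e) = chi p) ->
  \sum_(p <- raw_paths n.+1) chi p * f (path_src p) =
  \sum_(p <- raw_paths n) chi p * adj_op n f (path_src p).
Proof.
move=> chiE; rewrite /= big_allpairs_dep/= !big_seq; apply: eq_bigr => p pn.
rewrite /adj_op mulr_sumr /out_edges big_allpairs_dep; apply: eq_bigr => q _.
rewrite (eq_bigr (fun=> chi p * f q)) => [|j _]; last first.
  by rewrite chiE// /path_src map_rcons last_rcons.
rewrite big_const_seq count_predT size_enum_ord iter_addr_0.
by rewrite -[LHS]mulr_natl [LHS]mulrCA.
Qed.

(** The product of [j] consecutive adjacency matrices, the first being that of E_(n+1), applied to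
    [f]. *)
Fixpoint adj_opn n j (f : V -> R) : V -> R :=
  if j is j'.+1 then adj_op n (adj_opn n.+1 j' f) else f.

Lemma adj_op_period n f : adj_op (n + K) f = adj_op n f.
Proof.
apply/funext => v; apply: eq_bigr => q _; congr ((adj _ v q)%:R * _).
by apply/val_inj; rewrite /= modnDr.
Qed.

Lemma adj_opn_period n j f : adj_opn (n + K) j f = adj_opn n j f.
Proof. by elim: j n => //= j IH n; rewrite -addSn IH adj_op_period. Qed.

(** Exhibits the iterated operator as one nonnegative matrix, the form in which [mean_ergodic] can
    be applied. *)
Lemma adj_opn_kernel n j : exists B : V -> V -> R,
  (forall p q, 0 <= B p q) /\ forall f p, adj_opn n j f p = \sum_(q <- kvertices) B p q * f q.
Proof.
elim: j n => [|j IH] n.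
  exists (fun p q => (p == q)%:R); split=> // f p /=.
  rewrite (bigD1_seq p) ?uniq_kvertices ?mem_kvertices//= eqxx mul1r big1 ?addr0// => q qp.
  by rewrite eq_sym (negbTE qp) mul0r.
have [B [B0 BE]] := IH n.+1.
exists (fun p q => \sum_(r <- kvertices) (adj (inZp n : 'I_K) p r)%:R * B r q); split.
  by move=> p q; rewrite sumr_ge0// => r _; rewrite mulr_ge0.
move=> f p; rewrite /= /adj_op.
rewrite (eq_bigr (fun r =>
    \sum_(q <- kvertices) (adj (inZp n : 'I_K) p r)%:R * (B r q * f q))); last first.
  by move=> r _; rewrite BE mulr_sumr.
rewrite exchange_big/=; apply: eq_bigr => q _; rewrite mulr_suml.
by apply: eq_bigr => r _; rewrite mulrA.
Qed.

Lemma sum_raw_paths_adj_opn n j (chi : V * seq (bedge L) -> R) (f : V -> R) :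
  (forall n' p e, (n <= n')%N -> p \in raw_paths n' -> chi (p.1, rcons p.2 e) = chi p) ->
  \sum_(p <- raw_paths (n + j)) chi p * f (path_src p) =
  \sum_(p <- raw_paths n) chi p * adj_opn n j f (path_src p).
Proof.
elim: j n f => [|j IH] n f chiE; first by rewrite addn0.
rewrite addnS -addSn IH => [|n' p e nn']; last by apply: chiE; exact: ltnW.
by rewrite sum_raw_pathsS// => p e; exact: chiE.
Qed.

Definition paths n : seq (bpath L) := pmap insub (raw_paths n).

Lemma mem_paths n g : (g \in paths n) = (blength g == n).
Proof. by rewrite /paths mem_pmap_sub mem_raw_paths (valP g). Qed.

Lemma uniq_paths n : uniq (paths n).
Proof. exact/pmap_sub_uniq/uniq_raw_paths. Qed.

Lemma sum_paths n (F : V * seq (bedge L) -> R) :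
  \sum_(g <- paths n) F (val g) = \sum_(p <- raw_paths n) F p.
Proof.
rewrite -(big_map val xpredT F) /paths pmap_filter; last exact: insubK.
rewrite (_ : [seq x <- _ | _] = raw_paths n)//; apply/all_filterP/allP => p.
by rewrite mem_raw_paths => /andP[vp _]; rewrite /= insubT.
Qed.

End Paths.

(** * Sequences with linear partial sums up to a bounded error *)

Section LinearGrowth.
Context (R : realType).

Definition linear_growth (c : nat -> R) := exists beta C : R,
  forall n, `|\sum_(q < n) c q - beta *+ n| <= C.

Lemma linear_growth_scale (d : R) c : linear_growth c -> linear_growth (fun q => d * c q).
Proof.
move=> [beta [C cC]]; exists (d * beta), (`|d| * C) => n.
by rewrite -mulr_sumr -mulrnAr -mulrBr normrM ler_wpM2l.
Qed.

Lemma linear_growth_sum (I : Type) (r : seq I) (c : I -> nat -> R) :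
  (forall i, linear_growth (c i)) -> linear_growth (fun q => \sum_(i <- r) c i q).
Proof.
move=> lc; elim: r => [|i r [beta [C cC]]].
  by exists 0, 0 => n; rewrite big1 ?mul0rn ?subrr ?normr0// => q _; rewrite big_nil.
have [beta' [C' cC']] := lc i; exists (beta' + beta), (C' + C) => n.
under eq_bigr do rewrite big_cons.
rewrite big_split/= mulrnDl opprD addrACA.
by apply: le_trans (ler_normD _ _) _; apply: lerD; [exact: cC'|exact: cC].
Qed.

(** Finitely many initial terms affect only the constant [C]; this disposes of the paths shorter
    than lambda. *)
Lemma linear_growth_shift m c : linear_growth (fun q => c (m + q)%N) -> linear_growth c.
Proof.
elim: m c => [//|m IH] c lc.
have {lc} [beta [C cC]] : linear_growth (fun q => c q.+1) by apply: IH lc.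
exists beta, (C + `|c 0%N| + `|beta|) => -[|n].
  rewrite big_ord0 mulr0n subrr normr0 !addr_ge0//.
  by apply: le_trans (cC 0%N).
rewrite big_ord_recl mulrS opprD addrACA addrC.
apply: le_trans (ler_normD _ _) _; rewrite -[leRHS]addrA; apply: lerD; first exact: cC.
exact: ler_normB.
Qed.

End LinearGrowth.

(** * Weighted path sums and the common eigenvector *)

Section PerronFrobenius.
Context (R : realType) (k : nat) (L : kgraph k.+1) (finL : finite_kgraph L).
Local Notation V := (kobj L).
Local Notation K := k.+1.
Local Notation Vs := (kvertices L).
Context (x : V -> R) (rh : 'I_K -> R).
Hypothesis x_gt0 : forall v, 0 < x v.
Hypothesis sum_x : \sum_(v <- Vs) x v = 1.
Hypothesis adj_x : forall (i : 'I_K) v, \sum_(w <- Vs) (adj i v w)%:R * x w = rh i * x v.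
Hypothesis rh_gt0 : forall i, 0 < rh i.

Let rho := \prod_(i < K) rh i.

(** The base of the power in [w_delta] at length [n]. It is also the eigenvalue of [x] for the
    product of the first [n] adjacency matrices. *)
Definition level_weight n : R := \prod_(i < K) rh i ^+ (n %/ K + (i < n %% K))%N.
Local Notation P := level_weight.

Lemma level_weight_gt0 n : 0 < P n.
Proof. by apply: prodr_gt0 => i _; exact: exprn_gt0. Qed.

Lemma level_weight0 : P 0 = 1.
Proof. by rewrite /P big1// => i _; rewrite div0n mod0n expr0. Qed.

Lemma level_weightS n : P n.+1 = rh (inZp n) * P n.
Proof.
have E (i : 'I_K) : (n.+1 %/ K + (i < n.+1 %% K))%N =
    ((i == inZp n) + (n %/ K + (i < n %% K)))%N.
  rewrite -val_eqE /=; have iK := ltn_ord i; have nK := ltn_pmod n (ltn0Sn k).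
  have := divn_eq n K; set q := (n %/ K)%N; set t := (n %% K)%N in nK * => nE.
  (* Either the remainder grows within a period, or [t = k]: a period is complete, the quotient
     rises and the remainder returns to 0. *)
  have [tk|tk] := ltnP t k.
    have tS : (t.+1 < K)%N by [].
    rewrite nE -addnS divnMDl// modnMDl divn_small// modn_small// addn0.
    by rewrite ltnS [in LHS]leq_eqVlt; case: ltngtP => //=; lia.
  have {tk} tk : t = k by apply/eqP; rewrite eqn_leq tk andbT -ltnS.
  rewrite nE -addnS tk divnMDl// modnMDl divnn modnn /= addn0.
  by move: iK; rewrite ltnS; case: ltngtP => //= _ _; lia.
rewrite /P; under eq_bigr do rewrite E exprD.
rewrite big_split /=; congr (_ * _).
by rewrite (bigD1 (inZp n))//= eqxx expr1 big1 ?mulr1// => i /negbTE->; rewrite expr0.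
Qed.

Lemma level_weight_period n q : P (q * K + n) = rho ^+ q * P n.
Proof.
rewrite /P /rho -prodrXl -big_split/=; apply: eq_bigr => i _.
by rewrite divnMDl// modnMDl -exprD addnA.
Qed.

Lemma x_lower : exists2 m, 0 < m & forall v, m <= x v.
Proof.
suff [m m0 mx] : exists2 m, 0 < m & forall v, v \in Vs -> m <= x v.
  by exists m => // v; apply: mx; exact: mem_kvertices.
elim: (Vs) => [|v s [m m0 mx]]; first by exists 1.
exists (Num.min m (x v)); first by rewrite lt_min m0 x_gt0.
move=> w; rewrite inE => /orP[/eqP->|/mx H]; first by rewrite ge_min lexx orbT.
by rewrite ge_min H.
Qed.

Lemma x_le1 v : x v <= 1.
Proof.
rewrite -sum_x (bigD1_seq v) ?uniq_kvertices ?mem_kvertices//= lerDl.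
by rewrite sumr_ge0// => w _; exact: ltW.
Qed.

Lemma adj_op_x n : adj_op n x = fun v => rh (inZp n) * x v.
Proof. by apply/funext => v; exact: adj_x. Qed.

Lemma adj_opZ n c f : adj_op n (fun v : V => c * f v) = fun v => c * adj_op n f v :> R.
Proof.
by apply/funext => v; rewrite /adj_op mulr_sumr; apply: eq_bigr => q _; rewrite mulrCA.
Qed.

Lemma adj_opn_x n j : adj_opn n j x = fun v => P (n + j) / P n * x v.
Proof.
elim: j n => [|j IH] n /=.
  by apply/funext => v; rewrite addn0 divff ?mul1r// gt_eqF// level_weight_gt0.
rewrite IH adj_opZ adj_op_x; apply/funext => v.
rewrite addSnnS level_weightS mulrA; congr (_ * _).
by field; rewrite !gt_eqF// level_weight_gt0.
Qed.

Section Weighted.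
Context (chi : V * seq (bedge L) -> R) (m : nat).
Hypothesis chi_ge0 : forall p, 0 <= chi p.
Hypothesis chiE : forall n p e, (m <= n)%N -> p \in raw_paths L n ->
  chi (p.1, rcons p.2 e) = chi p.

Let Phi n (f : V -> R) := \sum_(p <- raw_paths L n) chi p * f (path_src p).

Lemma Phi_adj_opn n j f : (m <= n)%N -> Phi (n + j) f = Phi n (adj_opn n j f).
Proof.
move=> mn; apply: sum_raw_paths_adj_opn => n' p e nn'.
by apply: chiE; exact: leq_trans nn'.
Qed.

(** As [x] is a common eigenvector, [Phi n x / P n] does not depend on [n] from [m] on. This serves
    both to count paths and to bound block sums from below. *)
Lemma Phi_x n : (m <= n)%N -> Phi n x = P n / P m * Phi m x.
Proof.
move=> mn; rewrite -{1}(subnKC mn) Phi_adj_opn// adj_opn_x subnKC//.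
by rewrite /Phi mulr_sumr; apply: eq_bigr => p _; rewrite mulrCA.
Qed.

(** Lengthening by a whole period amounts to one application of a fixed nonnegative matrix that
    fixes [x], so [mean_ergodic] applies; [Phi n] is a positive functional, so it carries over the
    pointwise error bound. *)
Lemma Phi_linear_growth n f : (m <= n)%N ->
  linear_growth (fun q => Phi (n + q * K) f / P (n + q * K)).
Proof.
move=> mn.
have [B [B0 BE]] := adj_opn_kernel R finL n K.
have rho0 : 0 < rho by exact: prodr_gt0.
pose B' p q := B p q / rho.
have B'0 p q : 0 <= B' p q by rewrite divr_ge0// ltW.
pose U (f : V -> R) p := \sum_(q <- Vs) B' p q * f q.
have UE f' p : U f' p = adj_opn n K f' p / rho.
  by rewrite BE mulr_suml; apply: eq_bigr => q _; rewrite /B' mulrAC.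
have Bx p : \sum_(q <- Vs) B' p q * x q = x p.
  have nK : (n + K = 1 * K + n)%N by rewrite mul1n addnC.
  rewrite -/(U x p) UE adj_opn_x nK level_weight_period expr1.
  by field; rewrite !gt_eqF// level_weight_gt0.
have [w [C wC]] := mean_ergodic (uniq_kvertices L) (mem_kvertices finL) B'0 x_gt0 Bx f.
have PhiU q g : Phi (n + q * K) g / P (n + q * K) = Phi n (iter q U g) / P n.
  elim: q g => [|q IH] g; first by rewrite mul0n addn0.
  rewrite iterSr -IH mulSn addnA addnAC Phi_adj_opn; last first.
    by rewrite (leq_trans mn)// leq_addr.
  have -> : adj_opn (n + q * K) K g = adj_opn n K g.
    elim: (q) => [|q' IHq]; first by rewrite mul0n addn0.
    by rewrite mulSn addnCA addnC adj_opn_period IHq.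
  have -> : P (n + q * K + K) = rho * P (n + q * K).
    by rewrite addnC -{1}[K]mul1n level_weight_period expr1.
  rewrite invfM mulrA; congr (_ / _); rewrite /Phi mulr_suml.
  by apply: eq_bigr => p _; rewrite -mulrA -UE.
exists (Phi n w / P n), (Phi n (fun=> C) / P n) => j.
under eq_bigr do rewrite PhiU.
rewrite -mulr_suml -mulrnAl -mulrBl normrM normfV (gtr0_norm (level_weight_gt0 n)).
rewrite ler_wpM2r ?invr_ge0 ?(ltW (level_weight_gt0 n))//.
rewrite /Phi -sumrMnl exchange_big/= -sumrB.
apply: le_trans (ler_norm_sum _ _ _) _; apply: ler_sum => p _.
rewrite -mulr_sumr -mulrnAr -mulrBr normrM (ger0_norm (chi_ge0 p)) ler_wpM2l//.
exact: wC.
Qed.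

End Weighted.

(** For [chi = 1] the sum [Phi n x] equals [P n], since the entries of [x] add up to 1. Each path
    contributes between the minimum of [x] and 1. *)
Lemma size_raw_paths_bounds : exists2 m, 0 < m & forall n,
  P n <= (size (raw_paths L n))%:R <= P n / m.
Proof.
have [m m0 mx] := x_lower; exists m => // n.
have sizeE : (size (raw_paths L n))%:R = \sum_(p <- raw_paths L n) 1 * (1 : R).
  by rewrite big_const_seq count_predT iter_addr_0 mulr1.
have PE : P n = \sum_(p <- raw_paths L n) 1 * x (path_src p).
  have := @Phi_x (fun=> 1) 0 (fun _ _ _ _ _ => erefl) n isT.
  rewrite level_weight0 divr1 => ->.
  by rewrite [X in _ * X]big_map; under eq_bigr do rewrite mul1r; rewrite sum_x mulr1.
apply/andP; split.
  by rewrite PE sizeE ler_sum// => p _; rewrite !mul1r x_le1.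
rewrite PE sizeE mulr_suml ler_sum// => p _.
by rewrite !mul1r ler_pdivlMr// mul1r.
Qed.

End PerronFrobenius.

Lemma powR_le1 (R : realType) (x p : R) : 0 <= x -> x <= 1 -> 0 <= p -> x `^ p <= 1.
Proof.
move=> x0 x1 p0; apply: (@le_trans _ _ (1 `^ p)); last by rewrite powR1.
by rewrite ge0_ler_powR ?nnegrE.
Qed.

Lemma half_sum_diff (F : numFieldType) (W : lmodType F) (u v : W) :
  2^-1 *: (u + v) + 2^-1 *: (u - v) = u.
Proof.
by rewrite -scalerDr addrACA subrr addr0 -mulr2n -(scaler_nat 2 u) scalerA mulVf ?scale1r//.
Qed.

Lemma half_basisD (R : realType) (I : choiceType) (i j l : I) :
  (2^-1 *: (basis_vec R i + basis_vec R j)) l = 2^-1 * ((l == i)%:R + (l == j)%:R).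
Proof. by rewrite ell2Z ell2D !basis_vecE. Qed.

Lemma half_basisB (R : realType) (I : choiceType) (i j l : I) :
  (2^-1 *: (basis_vec R i - basis_vec R j)) l = 2^-1 * ((l == i)%:R - (l == j)%:R).
Proof. by rewrite ell2Z ell2B !basis_vecE. Qed.

(** * The operator on the path space *)

Section StationaryDiagram.
Context (R : realType) (k : nat) (L : kgraph k.+1) (finL : finite_kgraph L).
Context (delta : R) (delta_gt0 : 0 < delta) (delta_lt1 : delta < 1).
Context (w_weight : is_weight (w_delta (L := L) delta)).
Context (w_diam : forall g : bpath L, w_delta delta g = diam delta g).
Context (tau : bpath L -> ipath L * ipath L) (tau_choice : choice_function delta tau).
Context (lambda : bpath L).
Local Notation V := (kobj L).
Local Notation K := k.+1.
Local Notation Vs := (kvertices L).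
Local Notation x := (@pf_vector R _ L).
Local Notation rh := (@rho R _ L).
Local Notation P := (level_weight rh).
Let rho := \prod_(i < K) rh i.

(** Otherwise [pf_vector] would be its default value 0 and [w_delta] would vanish, against the
    positivity of a weight. *)
Let pf_vectorP : is_pf_vector x.
Proof.
rewrite /pf_vector; case: xgetP => [y _ //|noP].
have [w0 _ _ _] := w_weight; have := w0 (vertex_path (bpath_rng lambda)).
by rewrite /w_delta /pf_vector xgetPN// mulr0 ltxx.
Qed.

Let x_gt0 v : 0 < x v. Proof. by case: pf_vectorP. Qed.

Let sum_x : \sum_(v <- Vs) x v = 1.
Proof. by rewrite -fsum_kvertices//; case: pf_vectorP. Qed.

Let adj_x (i : 'I_K) v : \sum_(w <- Vs) (adj i v w)%:R * x w = rh i * x v.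
Proof. by rewrite -fsum_kvertices//; case: pf_vectorP. Qed.

Let y0 : ipath L := (tau lambda).1.

(** The edge of [y0] at level [i] shows that A_i has a positive entry; the eigenvector equation in
    its row then has a positive left side. *)
Let rh_gt0 i : 0 < rh i.
Proof.
have [ei _] := svalP y0 i; move: ei. case: (sval y0 i) => -[n [p q]] j.
rewrite /blevel/= => ni; move: j; rewrite /= ni valZpK => j.
have Apq : (0 < adj i p q)%N by case: j => j; exact: leq_ltn_trans.
rewrite -(pmulr_lgt0 _ (x_gt0 p)) -adj_x.
rewrite (bigD1_seq q) ?uniq_kvertices ?mem_kvertices//= ltr_pwDl//.
  by rewrite mulr_gt0// ltr0n.
by rewrite sumr_ge0// => w _; rewrite mulr_ge0// ltW.
Qed.

Let P_gt0 n : 0 < P n := level_weight_gt0 rh_gt0 n.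

Let w_deltaE g : w_delta delta g = P (blength g) `^ (- delta^-1) * x (path_src (val g)).
Proof. by []. Qed.

Let ipath_valid (y : ipath L) m n :
  valid_from m (brng (iedge y m)) [seq iedge y i | i <- iota m n].
Proof.
elim: n m => //= n IH m; have [-> yS] := svalP y m.
by rewrite !eqxx/= yS.
Qed.

Let ipath_initial (y : ipath L) n : exists g : bpath L, blength g = n.
Proof.
have H : valid_from 0 (brng (iedge y 0)) (mkseq (iedge y) n) by exact: ipath_valid.
by exists (exist _ (brng (iedge y 0), mkseq (iedge y) n) H); rewrite /blength/= size_mkseq.
Qed.

(** If rho <= 1, a path of length [q * K] has weight at least the value of [x] at its source, hence
    at least the minimum of [x]; but the weights tend uniformly to 0. *)
Let rho_gt1 : 1 < rho.
Proof.
have rho0 : 0 < rho by exact: prodr_gt0.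
rewrite ltNge; apply/negP => rho1.
have [m m0 mx] := x_lower finL x_gt0.
have [_ _ /fine_cvgP[wfin wcvg] _] := w_weight.
have /cvgr_lt/(_ _ m0) := wcvg.
move: wfin => [N1 _ wfin] [N2 _ wm].
pose q := maxn N1 N2.
have qK n : (n <= q)%N -> (n <= q * K)%N by move=> /leq_trans; apply; rewrite leq_pmulr.
have {}wfin := wfin _ (qK _ (leq_maxl N1 N2)).
have {}wm := wm _ (qK _ (leq_maxr N1 N2)).
have [g gq] := ipath_initial y0 (q * K).
have := lt_le_trans wm (mx (path_src (val g))).
rewrite ltNge -lee_fin fineK// => /negP; apply.
apply: (@le_trans _ _ (w_delta delta g)%:E); last by apply: ereal_sup_ubound; exists g.
rewrite lee_fin w_deltaE gq ler_peMl ?(ltW (x_gt0 _))//.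
have -> : P (q * K) = rho ^+ q.
  by rewrite -[(q * K)%N]addn0 level_weight_period level_weight0 mulr1.
rewrite powRN invf_ge1 ?powR_gt0 ?exprn_gt0//.
by rewrite powR_le1 ?invr_ge0 ?exprn_ge0 ?exprn_ile1 ?(ltW delta_gt0) ?(ltW rho0).
Qed.

Let rho_gt0 : 0 < rho := lt_trans ltr01 rho_gt1.

Let diam_powE g : diam (L := L) delta g `^ delta =
  (P (blength g))^-1 * x (path_src (val g)) `^ delta.
Proof.
rewrite -w_diam w_deltaE powRM ?powR_ge0 ?(ltW (x_gt0 _))// -powRrM mulNr mulVf ?gt_eqF//.
by rewrite powR_inv1// ltW.
Qed.

(** * The eigenvalues and their blocks *)

Local Notation I := (bpath L * bool)%type.
Let tau_b (gb : I) := if gb.2 then (tau gb.1).1 else (tau gb.1).2.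
Let a (gb : I) : R :=
  if `[< cylinder lambda (tau_b gb) >] then diam delta gb.1 `^ delta else 0.

Let lev (gb : I) := (blength gb.1 %/ K)%N.
Let lpaths q : seq (bpath L) := [seq g | t <- iota 0 K, g <- paths L (q * K + t)].
Let blk q : seq I := [seq (g, b) | g <- lpaths q, b <- [:: true; false]].

Let mem_lpaths q g : (g \in lpaths q) = (blength g %/ K == q)%N.
Proof.
apply/allpairsPdep/eqP => [[t [g' [tK + ->]]]|gq].
  rewrite (mem_paths finL) => /eqP ->; move: tK; rewrite mem_iota /= add0n => tK.
  by rewrite divnMDl// divn_small// addn0.
exists (blength g %% K)%N, g; rewrite mem_iota /= add0n ltn_pmod// (mem_paths finL).
by rewrite -gq -divn_eq.
Qed.

Let uniq_lpaths q : uniq (lpaths q).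
Proof.
apply: allpairs_uniq_dep => [|t _|]; [exact: iota_uniq|exact: uniq_paths|].
pose t_of (u : {_ : nat & bpath L}) := tag u.
pose g_of (u : {_ : nat & bpath L}) := tagged u.
move=> [t g] [t' g'] /allpairsPdep[t1 [g1 [_ + E1]]] /allpairsPdep[t2 [g2 [_ + E2]]] /= gg.
have [/= <- /= <-] := (congr1 t_of E1, congr1 g_of E1).
have [/= <- /= <-] := (congr1 t_of E2, congr1 g_of E2).
by rewrite !(mem_paths finL) gg => /eqP -> /eqP /addnI ->.
Qed.

Let mem_blk q gb : (gb \in blk q) = (lev gb == q).
Proof.
case: gb => g b; rewrite -mem_lpaths /=.
apply/allpairsP/idP => [[[g' b']/= [g'q _ [-> _]]]//|gq].
by exists (g, b); split=> //; case: b.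
Qed.

Let uniq_blk q : uniq (blk q).
Proof. by apply: allpairs_uniq => // -[g b] [g' b'] _ _ [-> ->]. Qed.

Let sum_blk (F : I -> R) q : \sum_(i <- blk q) F i =
  \sum_(t < K) \sum_(g <- paths L (q * K + t)) (F (g, true) + F (g, false)).
Proof.
rewrite big_allpairs big_allpairs_dep/= -(big_mkord xpredT (fun t =>
  \sum_(g <- paths L (q * K + t)) (F (g, true) + F (g, false)))).
rewrite /index_iota subn0; apply: eq_bigr => t _; apply: eq_bigr => g _.
by rewrite !big_cons big_nil addr0.
Qed.

Let size_blk q : (size (blk q))%:R =
  \sum_(t < K) 2 * (size (raw_paths L (q * K + t)))%:R :> R.
Proof.
have sumr1 (T : Type) (s : seq T) : \sum_(i <- s) (1 : R) = (size s)%:R.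
  by rewrite big_const_seq count_predT iter_addr_0.
rewrite -sumr1 sum_blk; apply: eq_bigr => t _.
by rewrite (sum_paths finL _ (fun=> 1 + 1)) -sumr1 mulr_sumr; apply: eq_bigr => p _; rewrite mulr1.
Qed.

Let P_blk q t : P (q * K + t) = rho ^+ q * P t.
Proof. exact: level_weight_period. Qed.

(** The factor 2 counts the two coordinates of each path. *)
Let d1 := 2 * \sum_(t < K) P t.

Let sumP_gt0 : 0 < \sum_(t < K) P t.
Proof. by rewrite big_ord_recl ltr_pwDl// sumr_ge0// => t _; rewrite ltW. Qed.

Let size_blk_bounds : exists d2, forall q,
  d1 * rho ^+ q <= (size (blk q))%:R <= d2 * rho ^+ q.
Proof.
have [m m0 Pm] := size_raw_paths_bounds finL x_gt0 sum_x adj_x rh_gt0.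
exists (d1 / m) => q; rewrite size_blk -mulr_sumr /d1.
have -> : 2 * (\sum_(t < K) P t) * rho ^+ q = 2 * \sum_(t < K) P (q * K + t).
  by rewrite -mulrA mulr_suml; congr (_ * _); apply: eq_bigr => t _; rewrite P_blk mulrC.
have -> : 2 * (\sum_(t < K) P t) / m * rho ^+ q = 2 * \sum_(t < K) (P (q * K + t) / m).
  rewrite -!mulrA !mulr_suml; congr (_ * _); apply: eq_bigr => t _.
  by rewrite P_blk; field; rewrite gt_eqF.
by rewrite !ler_pM2l//; apply/andP; split; apply: ler_sum => t _; case/andP: (Pm (q * K + t)%N).
Qed.

Let a_ge0 i : 0 <= a i.
Proof. by rewrite /a; case: ifP => // _; exact: powR_ge0. Qed.

(** A sum standing in for the maximum of the 1 / P t over the residues t. *)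
Let c2 := \sum_(t < K) (P t)^-1.

Let c2_gt0 : 0 < c2.
Proof.
rewrite /c2 big_ord_recl ltr_pwDl ?invr_gt0// sumr_ge0// => t _.
by rewrite invr_ge0 ltW.
Qed.

Let x_pow_le1 v : x v `^ delta <= 1.
Proof.
rewrite powR_le1 ?(ltW delta_gt0) ?(ltW (x_gt0 v))//.
exact: (x_le1 finL x_gt0 sum_x).
Qed.

Let P_lev n : P n = rho ^+ (n %/ K) * P (n %% K).
Proof. by rewrite -P_blk -divn_eq. Qed.

Let diam_pow_le g : diam (L := L) delta g `^ delta <= c2 / rho ^+ (blength g %/ K).
Proof.
rewrite diam_powE P_lev; set n := blength g.
rewrite invfM -mulrA [leLHS]mulrC ler_wpM2r ?invr_ge0 ?exprn_ge0 ?(ltW rho_gt0)//.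
have nK : (n %% K < K)%N by rewrite ltn_pmod.
apply: (@le_trans _ _ (P (n %% K))^-1).
  by rewrite ler_piMr// invr_ge0 ltW.
rewrite /c2 (bigD1 (Ordinal nK))//= lerDl sumr_ge0// => t _.
by rewrite invr_ge0 ltW.
Qed.

Let a_le i : a i <= c2 / rho ^+ lev i.
Proof.
rewrite /a; case: ifP => _; first exact: diam_pow_le.
by rewrite divr_ge0 ?exprn_ge0 ?(ltW rho_gt0) ?(ltW c2_gt0).
Qed.

Let a_ge : exists2 c1, 0 < c1 & forall i, a i != 0 -> c1 / rho ^+ lev i <= a i.
Proof.
have [m m0 mx] := x_lower finL x_gt0.
exists (m `^ delta / \sum_(t < K) P t); first by rewrite divr_gt0 ?powR_gt0.
move=> [g b]; rewrite /a; case: ifP => [_ _|]; last by rewrite eqxx.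
rewrite diam_powE P_lev /lev/=; set n := blength g.
rewrite invfM -[leRHS]mulrA [leRHS]mulrC ler_wpM2r ?invr_ge0 ?exprn_ge0 ?(ltW rho_gt0)//.
rewrite [leLHS]mulrC; apply: ler_pM; rewrite ?invr_ge0 ?powR_ge0 ?(ltW sumP_gt0)//.
  have nK : (n %% K < K)%N by rewrite ltn_pmod.
  rewrite lef_pV2 ?posrE// (bigD1 (Ordinal nK))//= lerDl sumr_ge0// => t _.
  exact: ltW.
by rewrite ge0_ler_powR ?nnegrE ?(ltW delta_gt0) ?(ltW m0) ?(ltW (x_gt0 _)).
Qed.

(** * Linear growth of the block sums *)

Let m := blength lambda.
Let chib (p : V * seq (bedge L)) := (p.1 == bpath_rng lambda) && (take m p.2 == bpath_edges lambda).
Let chi p : R := (chib p)%:R.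

Let tau_b_cylinder gb : cylinder gb.1 (tau_b gb).
Proof. by case: gb => g b; rewrite /tau_b; have [] := tau_choice g; case: b. Qed.

(** Since tau(g) lies in [g], the first [m] edges of [g] decide whether it lies in [lambda],
    provided that [g] is long enough. For shorter [g] the answer depends on tau. *)
Let cylinder_chib gb : (m <= blength gb.1)%N ->
  `[< cylinder lambda (tau_b gb) >] = chib (val gb.1).
Proof.
move=> mg; have [rg eg] := tau_b_cylinder gb; rewrite /chib.
have -> : (val gb.1).1 = bpath_rng gb.1 by [].
have -> : (val gb.1).2 = bpath_edges gb.1 by [].
rewrite rg eg /mkseq -map_take take_iota (minn_idPl mg).
apply/asboolP/andP => [[-> ->]//|[/eqP rl /eqP el]].
by split; [rewrite rl|rewrite /mkseq el].
Qed.

Let chi_ge0 p : 0 <= chi p. Proof. exact: ler0n. Qed.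

Let chiE n p e : (m <= n)%N -> p \in raw_paths L n -> chi (p.1, rcons p.2 e) = chi p.
Proof.
move=> mn; rewrite (mem_raw_paths finL) => /andP[_ /eqP pn].
by rewrite /chi /chib /= -cats1 takel_cat// pn.
Qed.

Let xd v := x v `^ delta.
Let Phi n (f : V -> R) := \sum_(p <- raw_paths L n) chi p * f (path_src p).
Let S n := \sum_(g <- paths L n) (a (g, true) + a (g, false)).

Let S_Phi n : (m <= n)%N -> S n = 2 * (Phi n xd / P n).
Proof.
move=> mn; rewrite /S big_seq.
rewrite (eq_bigr (fun g => 2 * (chi (val g) * xd (path_src (val g)) / P n))); last first.
  move=> g; rewrite (mem_paths finL) => /eqP gn.
  have aE b : a (g, b) = chi (val g) * xd (path_src (val g)) / P n.
    rewrite /a cylinder_chib /= ?gn// /chi diam_powE gn.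
    by case: ifP => _; rewrite ?mul0r// mul1r mulrC.
  by rewrite !aE mulr2n mulrDl mul1r.
rewrite -big_seq (sum_paths finL n (fun p => 2 * (chi p * xd (path_src p) / P n))).
by rewrite -mulr_sumr -mulr_suml.
Qed.

Let S_linear_growth t : linear_growth (fun q => S (q * K + t)).
Proof.
(* Skipping [m] blocks makes all lengths at least [m], as m <= m K. *)
apply: (@linear_growth_shift _ m).
have mn : (m <= m * K + t)%N by rewrite (leq_trans (leq_pmulr m (ltn0Sn k)))// leq_addr.
rewrite (_ : (fun q => _) = fun q => 2 * (Phi (m * K + t + q * K) xd / P (m * K + t + q * K))).
  apply: linear_growth_scale.
  exact: (Phi_linear_growth finL x_gt0 adj_x rh_gt0 chi_ge0 chiE).
apply/funext => q; rewrite mulnDl addnAC S_Phi//.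
by rewrite (leq_trans mn)// leq_addr.
Qed.

Let b q := \sum_(i <- blk q) a i.

Let b_linear_growth : linear_growth b.
Proof.
rewrite (_ : b = fun q => \sum_(t < K) S (q * K + t)).
  exact: linear_growth_sum.
by apply/funext => q; rewrite /b sum_blk.
Qed.

Let b0 := 2 * (Phi m x / P m).

Let b0_gt0 : 0 < b0.
Proof.
rewrite mulr_gt0// divr_gt0// /Phi.
have lm : val lambda \in raw_paths L m.
  by rewrite (mem_raw_paths finL) (valP lambda) eqxx.
rewrite (bigD1_seq (val lambda)) ?uniq_raw_paths//= ltr_pwDl//; last first.
  by rewrite sumr_ge0// => p _; rewrite mulr_ge0// ltW.
have -> : chi (val lambda) = 1.
  by rewrite /chi /chib eqxx take_oversize ?eqxx.
by rewrite mul1r.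
Qed.

(** Only the residue 0 is kept. There [xd] dominates [x], as 0 < x <= 1 and delta < 1, and the
    normalised sum with [x] in place of [xd] is exactly [b0]. *)
Let b_ge q : (m <= q)%N -> b0 <= b q.
Proof.
move=> mq; have mqK : (m <= q * K + 0)%N.
  by rewrite addn0 (leq_trans mq)// leq_pmulr.
rewrite /b sum_blk big_ord_recl -[leLHS]addr0; apply: lerD; last first.
  by rewrite sumr_ge0// => t _; rewrite sumr_ge0// => g _; rewrite addr_ge0.
rewrite -/(S (q * K + 0)) S_Phi// /b0 ler_pM2l//.
have PhiE : Phi (q * K + 0) x = P (q * K + 0) / P m * Phi m x := Phi_x adj_x rh_gt0 chiE mqK.
apply: (@le_trans _ _ (Phi (q * K + 0) x / P (q * K + 0))).
  by rewrite PhiE le_eqVlt; apply/orP; left; apply/eqP; field; rewrite !gt_eqF.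
rewrite ler_wpM2r ?invr_ge0 ?(ltW (P_gt0 _))// ler_sum// => p _.
rewrite ler_wpM2l// /xd ger1_powR ?(ltW delta_lt1)//.
by rewrite x_gt0 (x_le1 finL x_gt0 sum_x).
Qed.

(** If beta <= 0, the linear term only helps, and n b0 <= C for all n, which is impossible for
    [b0 > 0]. *)
Let beta_gt0 beta C : (forall n, `|\sum_(q < n) b q - beta *+ n| <= C) -> 0 < beta.
Proof.
move=> bC; rewrite ltNge; apply/negP => beta0.
suff : b0 = 0 by move/eqP; rewrite gt_eqF.
apply: (@bounded_mulrn_eq0 _ _ C) => n; rewrite ger0_norm ?mulrn_wge0 ?(ltW b0_gt0)//.
apply: le_trans (bC (m + n)%N); apply: le_trans (ler_norm _).
rewrite -[leLHS]addr0; apply: lerD; last by rewrite oppr_ge0 mulrn_wle0.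
rewrite big_split_ord /= -[leLHS]add0r; apply: lerD.
  by rewrite sumr_ge0// => q _; rewrite /b sumr_ge0.
rewrite -[X in _ *+ X]card_ord -sumr_const ler_sum// => q _.
by apply: b_ge; exact: leq_addr.
Qed.

(** * Functional calculus of the Dirac operator *)

Let diam_gt0 g : 0 < diam (L := L) delta g.
Proof. by rewrite -w_diam; case: w_weight. Qed.

Let diam_pow_bnd : exists M : R, forall gb : I, diam (L := L) delta gb.1 `^ delta <= M.
Proof.
exists c2 => gb; apply: le_trans (diam_pow_le _) _.
by rewrite ler_pdivrMr ?exprn_gt0// ler_peMr ?(ltW c2_gt0)// exprn_ege1// ltW.
Qed.

Let diam_bounded : bounded_entries (fun gb : I => (diam (L := L) delta gb.1 `^ delta)%:C).
Proof. by apply: diag_bounded_entries => // gb; exact: powR_ge0. Qed.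

(** On the [g]-summand, D is the swap divided by the diameter, with eigenvalues 1 / diam and -1 /
    diam. Both have the same absolute value, so the power of |D| is scalar there. *)
Let abs_dirac_powE : abs_dirac_pow (L := L) delta (- delta) =
  mul_op (fun gb : I => (diam delta gb.1 `^ delta)%:C).
Proof.
apply: spectral_funE => //.
- move=> mu u [g c] Du ui.
  have E1 := Du g c; have E2 := Du g (~~ c).
  move: E1 E2; rewrite !ell2Z negbK => E1 E2.
  set d := diam delta g in E1 E2 *.
  (* Using the eigenvalue relation at both coordinates of the summand amounts to applying D twice,
     where the swap cancels. *)
  have mu2 : mu ^+ 2 = d^-1 ^+ 2.
    have : (mu ^+ 2)%:C * u (g, c) = (d^-1 ^+ 2)%:C * u (g, c).
      by rewrite !expr2 !rmorphM/= -!mulrA E1 mulrCA E2 mulrA.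
    by move=> /(mulIf ui) [].
  have -> : `|mu| = d^-1.
    apply/eqP; rewrite -(@eqrXn2 _ 2) ?invr_ge0 ?(ltW (diam_gt0 g))//.
    by rewrite real_normK ?num_real// mu2.
  by rewrite -powR_inv1 ?(ltW (diam_gt0 g))// -powRrM mulN1r opprK.
- move=> [g c]; set d := diam delta g.
  (* The basis vector is the sum of its symmetric and antisymmetric halves under the swap. *)
  exists [:: (d^-1, 2^-1 *: (basis_vec R (g, c) + basis_vec R (g, ~~ c)));
             (- d^-1, 2^-1 *: (basis_vec R (g, c) - basis_vec R (g, ~~ c)))].
  split; last first.
    by rewrite big_cons big_seq1 /= half_sum_diff.
  have neg1 : forall b' : bool, (~~ b' == c) = (b' == ~~ c) by case; case: (c).
  have neg2 : forall b' : bool, (~~ b' == ~~ c) = (b' == c) by case; case: (c).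
  move=> p; rewrite !inE => /orP[] /eqP -> /= g' c'.
  - rewrite [LHS]ell2Z !half_basisD !xpair_eqE neg1 neg2.
    have [->|] := eqVneq g' g; last by rewrite /= !addr0 !mulr0.
    by rewrite /= addrC.
  - rewrite [LHS]ell2Z !half_basisB !xpair_eqE neg1 neg2.
    have [->|] := eqVneq g' g; last by rewrite /= !subr0 !mulr0.
    by rewrite /= -[X in _ * (_ * X) = _]opprB !mulrN rmorphN mulNr opprK.
Qed.

Let T_diag : pi_tau tau (char_fun R (cylinder lambda)) \o abs_dirac_pow delta (- delta) =
  mul_op (fun gb : I => (a gb)%:C).
Proof.
rewrite abs_dirac_powE mul_op_comp//; last first.
  exists 1 => gb; rewrite /char_fun; case: `[< _ >]; first by rewrite normc1.
  by rewrite normc0 ler01.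
congr mul_op; apply/funext => gb; rewrite /char_fun /a /tau_b.
by case: `[< _ >]; rewrite ?mul1r// mul0r.
Qed.

Lemma dixmier_trace_cylinder :
  let T := pi_tau tau (char_fun R (cylinder lambda)) \o abs_dirac_pow delta (- delta) in
  exists c : R, [/\ 0 < c, connes_measurable T c%:C &
    ((s - 1)%:E * op_trace (op_pow T s))%E @[s --> 1^'+] --> c%:E].
Proof.
rewrite /= T_diag.
have [c1 c1_gt0 a_ge1] := a_ge.
have [d2 size_d] := size_blk_bounds.
have [beta [C bC]] := b_linear_growth.
have beta0 := beta_gt0 bC.
have d1_gt0 : 0 < d1 by rewrite mulr_gt0.
have size_ge q : d1 * rho ^+ q <= (size (blk q))%:R by case/andP: (size_d q).
have size_le q : (size (blk q))%:R <= d2 * rho ^+ q by case/andP: (size_d q).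
have [cm tr] := geometric_blocks_dixmier uniq_blk mem_blk rho_gt1 c1_gt0 c2_gt0 d1_gt0
  a_ge0 a_ge1 a_le size_ge size_le (ltW beta0) bC.
by exists (beta / ln rho); split=> //; rewrite divr_gt0// ln_gt0.
Qed.

End StationaryDiagram.

Theorem theorem3p18 (R : realType) (k : nat) (L : kgraph k.+1)
    (finL : finite_kgraph L) (scL : strongly_connected L)
    (delta : R) (delta_gt0 : 0 < delta) (delta_lt1 : delta < 1)
    (w_weight : is_weight (w_delta (L := L) delta))
    (w_diam : forall g : bpath L, w_delta delta g = diam delta g)
    (tau : bpath L -> ipath L * ipath L) (tau_choice : choice_function delta tau)
    (lambda : bpath L) :
  let T := pi_tau tau (char_fun R (cylinder lambda)) \o abs_dirac_pow delta (- delta) in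
  exists c : R, [/\ 0 < c, connes_measurable T c%:C &
    ((s - 1)%:E * op_trace (op_pow T s))%E @[s --> 1^'+] --> c%:E].
Proof. exact: dixmier_trace_cylinder. Qed.
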